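(* Let $b,\Delta\in R=\mathbb{F}_{2^n}[T]$ with $b\neq0$ and $\Delta\notin\varphi(R)$, where $\varphi(t)=t^2+bt$. Then $C(b,\Delta)$ is a finite Abelian group under direct composition.
   Context: $R=\mathbb{F}_{2^n}[T]$. The triple $(a,b,c)\in R^3$ denotes the binary quadratic form $ax^2+bxy+cy^2$; it is primitive if $a,b,c$ have no common non-unit divisor. Fix a subgroup $G$ of $(\mathbb{F}_{2^n},+)$ with $\#G=2^{n-1}$ and $1\notin G$, and set $R_b=\{qb+r : q,r\in R,\ \deg r<\deg b,\ q(0)\in G\}$ (with $\deg0=-\infty$), a subgroup of $(R,+)$ such that for every $k\in R$ exactly one of $k,k+b$ lies in $R_b$. For $\gamma=\begin{pmatrix} p & q \\ r & s \end{pmatrix}\in Sl_2(R)$ put $\gamma(a,b,c)=(ap^2+bpq+cq^2,\ b,\ ar^2+brs+cs^2)$. Primitive forms $(a,b,c)$ and $(A,b,C)$ are properly equivalent if there is such a $\gamma$ with $\gamma(a,b,c)=(A,b,C)$ and $apr+bqr+cqs\in R_b$. This is an equivalence relation; $[(a,b,c)]$ denotes the class. $C(b,\Delta)=\{[(a,b,c)] : (a,b,c)\text{ primitive},\ a,c\in R,\ ac\equiv\Delta\bmod\varphi(R)\}$. A form $(a_3,b,c_3)$ is a direct composition of $(a_1,b,c_1)$ and $(a_2,b,c_2)$ if there exist $p_i,q_i,r_i,s_i\in R$ ($i=1,2$) such that, as polynomials in $x,y,z,w$, $$(a_1x^2+bxy+c_1y^2)(a_2z^2+bzw+c_2w^2)=a_3L_1^2+bL_1L_2+c_3L_2^2,\quad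 L_i=p_ixz+q_ixw+r_iyz+s_iyw,$$ and $q_1r_2+q_2r_1\in R_b$, $p_2s_1+q_2r_1\in R_b$. Direct composition induces a well-defined operation on $C(b,\Delta)$: $[(a_1,b,c_1)][(a_2,b,c_2)]=[(a_3,b,c_3)]$ for any direct composition $(a_3,b,c_3)$. *)

(* Defs.v *)
From HB Require Import structures.
From mathcomp Require Import all_boot all_order all_algebra.
From mathcomp Require Import mpoly.
From mathcomp Require Import boolp classical_sets functions cardinality.

Set Implicit Arguments.
Unset Strict Implicit.
Unset Printing Implicit Defensive.

Import GRing.Theory.
Local Open Scope classical_set_scope.
Local Open Scope ring_scope.

Record bqf (F : finFieldType) := Bqf {
  qa : {poly F};
  qb : {poly F};
  qc : {poly F}
}.

Definition primitive_form (F : finFieldType) (f : bqf F) : Prop :=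
  forall d : {poly F},
    d %| qa f -> d %| qb f -> d %| qc f -> d \is a GRing.unit.

Definition phi (F : finFieldType) (b t : {poly F}) : {poly F} :=
  t ^+ 2 + b * t.

(* [size r < size b] is [deg r < deg b] with [deg 0 = -oo]. *)
Definition Rset (F : finFieldType) (G : {set F}) (b : {poly F}) :
    set {poly F} :=
  [set k | exists q r : {poly F},
     [/\ k = q * b + r, (size r < size b)%N & q.[0] \in G]].

Definition form_act (F : finFieldType) (g : 'M[{poly F}]_2) (f : bqf F) :
    bqf F :=
  let a := qa f in let b := qb f in let c := qc f in
  let p := g 0 0 in let q := g 0 1 in let r := g 1 0 in let s := g 1 1 in
  Bqf (a * p ^+ 2 + b * p * q + c * q ^+ 2)
      b
      (a * r ^+ 2 + b * r * s + c * s ^+ 2).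

Definition cross_term (F : finFieldType) (g : 'M[{poly F}]_2) (f : bqf F) :
    {poly F} :=
  let a := qa f in let b := qb f in let c := qc f in
  let p := g 0 0 in let q := g 0 1 in let r := g 1 0 in let s := g 1 1 in
  a * p * r + b * q * r + c * q * s.

Definition proper_equiv (F : finFieldType) (G : {set F}) (f f' : bqf F) :
    Prop :=
  [/\ primitive_form f, primitive_form f' &
      exists g : 'M[{poly F}]_2,
        [/\ \det g = 1, form_act g f = f' &
            Rset G (qb f) (cross_term g f)]].

Definition form_class (F : finFieldType) (G : {set F}) (f : bqf F) :
    set (bqf F) :=
  [set f' | proper_equiv G f f'].

Definition forms (F : finFieldType) (b Delta : {poly F}) : set (bqf F) :=
  [set f | [/\ primitive_form f, qb f = b &
               range (phi b) (qa f * qc f - Delta)]].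

Definition classes_of_forms (F : finFieldType) (G : {set F})
    (b Delta : {poly F}) : set (set (bqf F)) :=
  form_class G @` forms b Delta.

Definition form_at (F : finFieldType) (f : bqf F)
    (u v : {mpoly {poly F}[4]}) : {mpoly {poly F}[4]} :=
  qa f *: u ^+ 2 + qb f *: (u * v) + qc f *: v ^+ 2.

Definition bilin (F : finFieldType) (p q r s : {poly F})
    (x y z w : {mpoly {poly F}[4]}) : {mpoly {poly F}[4]} :=
  p *: (x * z) + q *: (x * w) + r *: (y * z) + s *: (y * w).

Definition direct_composition (F : finFieldType) (G : {set F})
    (f1 f2 f3 : bqf F) : Prop :=
  [/\ qb f2 = qb f1, qb f3 = qb f1 &
      exists p1 q1 r1 s1 p2 q2 r2 s2 : {poly F},
        let x := 'X_(inord 0) : {mpoly {poly F}[4]} in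
        let y := 'X_(inord 1) : {mpoly {poly F}[4]} in
        let z := 'X_(inord 2) : {mpoly {poly F}[4]} in
        let w := 'X_(inord 3) : {mpoly {poly F}[4]} in
        [/\ form_at f1 x y * form_at f2 z w
              = form_at f3 (bilin p1 q1 r1 s1 x y z w)
                           (bilin p2 q2 r2 s2 x y z w),
            Rset G (qb f1) (q1 * r2 + q2 * r1)
          & Rset G (qb f1) (p2 * s1 + q2 * r1)]].

(* The union of the classes of all direct compositions of a member of [X] and
   a member of [Y]; it is a single class exactly when at least one such direct
   composition with primitive result exists and all of them are equivalent. *)
Definition class_mul (F : finFieldType) (G : {set F}) (X Y : set (bqf F)) :
    set (bqf F) :=
  [set f | exists f1 f2 f3,
     [/\ X f1, Y f2, direct_composition G f1 f2 f3 & form_class G f3 f]].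

Definition finite_abelian_group (T : Type) (A : set T) (op : T -> T -> T) :
    Prop :=
  [/\ finite_set A,
      forall x y, A x -> A y -> A (op x y),
      forall x y z, A x -> A y -> A z -> op x (op y z) = op (op x y) z,
      forall x y, A x -> A y -> op x y = op y x
    & exists e, [/\ A e,
        forall x, A x -> op e x = x
      & forall x, A x -> exists2 y, A y & op y x = e]].

(* Main.v *)
Require Import Defs.
From HB Require Import structures.
From mathcomp Require Import all_boot all_order all_algebra.
From mathcomp Require Import finfield mpoly ring zify.
From mathcomp Require Import boolp classical_sets functions cardinality.

Set Implicit Arguments.
Unset Strict Implicit.
Unset Printing Implicit Defensive.

Import GRing.Theory.
Local Open Scope classical_set_scope.
Local Open Scope ring_scope.

(** Forms are compared with lattices in the quadratic order [R[w]], where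
    [w ^+ 2 + b * w = Delta].  As [Delta] is not of the form [t ^+ 2 + b * t],
    this order is a domain.  If [f] is the form [(a, b, c)] then
    [a * c = Delta + t ^+ 2 + b * t] for exactly two values of [t], which differ
    by [b], and exactly one of them lies in [Rset G b]; with that [t], called
    the orientation of [f], the lattice of [f] is [R * a + R * (t + w)], and
    [f] is the norm on that lattice divided by [a].  The set [Rset G b] thus
    chooses between a lattice and its conjugate.

    The proof rests on two translations.  Proper equivalence of forms is
    similarity of lattices ([similar_proper], [proper_similar]): a change of
    basis of determinant 1 adds the cross term to [t], so the condition on the
    cross term says that the orientation goes to the orientation; conversely
    every constant is a square, so that a similarity can be scaled to
    determinant 1.  A direct composition of [f1] and [f2] has a lattice similar
    to the product of the two lattices ([composition_similar]): the composition
    identity determines four minors of the matrix of the bilinear substitution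
    and the sum of the other two; these show that the substitution is multiplication in the order up to
    replacing a root [t] by [t + b], and the two conditions on [Rset G b] rule
    out that replacement.  Since products of lattices respect similarity, the
    operation on classes is well defined ([class_mul_eq]).

    For the group laws it is enough to compose well chosen representatives.
    The forms [(a1, b, a2 * c)] and [(a2, b, a1 * c)] have the direct
    composition [(a1 * a2, b, c)] ([direct_composition_concordant]), and any
    three classes contain forms [(a1, b, a2 * a3 * c)], [(a2, b, a1 * a3 * c)],
    [(a3, b, a1 * a2 * c)] ([concordant_triple]).  Existence of products,
    commutativity and associativity can be read off from these.  The identity is
    the class of [(1, b, Delta)], and [(c, b, a)] is inverse to [(a, b, c)].
    Finiteness comes from reduction: every lattice is similar to one whose [a]
    and [t] have bounded degree ([similar_reduced]). *)

(** * Preliminaries on determinants and on the base field *)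

Lemma det_mx22 (R : comNzRingType) (g : 'M[R]_2) :
  \det g = g 0 0 * g 1 1 - g 0 1 * g 1 0.
Proof.
rewrite (expand_det_row g 0) !big_ord_recl big_ord0 /cofactor !det_mx11 !mxE /=.
have -> : lift 0 0 = 1 :> 'I_2 by apply: val_inj.
have -> : lift 1 0 = 0 :> 'I_2 by apply: val_inj.
by rewrite expr0 expr1; ring.
Qed.

Lemma pow2_card_gt0 (F : finFieldType) n : #|F| = (2 ^ n)%N -> (0 < n)%N.
Proof.
case: n => // cardF; have := max_card (mem [set (0 : F); 1]%SET).
by rewrite cards2 eq_sym oner_eq0 cardF.
Qed.

(** As [x ^+ #|F| = x] for every [x] and [#|F|] is even, [x = - 1] gives
    [1 = - 1]. *)
Lemma pow2_card_char2 (F : finFieldType) n : #|F| = (2 ^ n)%N ->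
  2%:R = 0 :> F.
Proof.
move=> cardF; have := @expf_card F (- 1).
rewrite cardF -(prednK (pow2_card_gt0 cardF)) expnS exprM sqrrN !expr1n.
by move/eqP; rewrite -subr_eq0 opprK => /eqP.
Qed.

Lemma pow2_card_sqrt (F : finFieldType) n : #|F| = (2 ^ n)%N ->
  forall x : F, exists y, x = y ^+ 2.
Proof.
move=> cardF x; exists (x ^+ (2 ^ n.-1)).
by rewrite -exprM -expnSr prednK ?(pow2_card_gt0 cardF) // -cardF expf_card.
Qed.

(** [G] and its translate by [1] are disjoint, and each has half the size of
    the field. *)
Lemma index2_cover (F : finFieldType) n (G : {set F}) :
  #|F| = (2 ^ n)%N -> zmod_closed G -> #|G| = (2 ^ n.-1)%N -> 1 \notin G ->
  forall x, x \in G \/ x + 1 \in G.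
Proof.
move=> cardF [G0 GB] cardG notin1G x.
pose G1 : {set F} := [set y + 1 | y in G]%SET.
have card1 : #|G1| = (2 ^ n.-1)%N by rewrite card_imset // => y z /addIr.
have dis : (G :&: G1)%SET = finset.set0.
  apply/setP => y; rewrite !inE; apply/negP => /andP[yG /imsetP[z zG ey]].
  move/negP: notin1G; apply.
  by have := GB _ _ yG zG; rewrite ey addrAC subrr add0r.
have full : (G :|: G1)%SET = finset.setTfor F.
  apply/eqP; rewrite eqEcard finset.subsetT cardsT cardF cardsU dis.
  rewrite cards0 cardG card1 subn0 addnn -muln2 -expnSr prednK ?leqnn //.
  exact: pow2_card_gt0 cardF.
have : x \in (G :|: G1)%SET by rewrite full inE.
rewrite inE => /orP[|/imsetP[z zG ->]]; first by left.
by right; rewrite -addrA -mulr2n (pow2_card_char2 cardF) addr0.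
Qed.

(** * The quadratic order *)

(** The ring [R[w]] with [w ^+ 2 = b * w + Delta]; the pair [(x, y)] stands for
    [x + y * w].  The parameters are phantom so that the multiplication can be
    found from the type. *)
Definition quad (F : finFieldType) (b Delta : {poly F}) : Type :=
  ({poly F} * {poly F})%type.

HB.instance Definition _ (F : finFieldType) (b Delta : {poly F}) :=
  GRing.Zmodule.on (quad b Delta).

Section QuadRing.
Variables (F : finFieldType) (b Delta : {poly F}).
Local Notation A := (quad b Delta).

Definition quad_one : A := (1, 0).
Definition quad_mul (z w : A) : A :=
  (z.1 * w.1 + Delta * (z.2 * w.2),
   z.1 * w.2 + z.2 * w.1 + b * (z.2 * w.2)).

Lemma quad_eq (z w : A) : z.1 = w.1 -> z.2 = w.2 -> z = w.
Proof. by case: z w => [? ?] [? ?] /= -> ->. Qed.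

Lemma quad_mulA : associative quad_mul.
Proof. by move=> x y z; apply: quad_eq => /=; ring. Qed.
Lemma quad_mulC : commutative quad_mul.
Proof. by move=> x y; apply: quad_eq => /=; ring. Qed.
Lemma quad_mul1 : left_id quad_one quad_mul.
Proof. by move=> x; apply: quad_eq => /=; ring. Qed.
Lemma quad_mulD : left_distributive quad_mul +%R.
Proof. by move=> x y z; apply: quad_eq => /=; ring. Qed.
Lemma quad_1neq0 : quad_one != 0.
Proof. by apply/eqP=> /(congr1 (fun z : A => z.1)) /eqP; rewrite oner_eq0. Qed.

HB.instance Definition _ := GRing.Zmodule_isComNzRing.Build A
  quad_mulA quad_mulC quad_mul1 quad_mulD quad_1neq0.

Lemma quad_mul1E (z w : A) : (z * w).1 = z.1 * w.1 + Delta * (z.2 * w.2).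
Proof. by []. Qed.
Lemma quad_mul2E (z w : A) :
  (z * w).2 = z.1 * w.2 + z.2 * w.1 + b * (z.2 * w.2).
Proof. by []. Qed.
Lemma quad_add1E (z w : A) : (z + w).1 = z.1 + w.1.
Proof. by []. Qed.
Lemma quad_add2E (z w : A) : (z + w).2 = z.2 + w.2.
Proof. by []. Qed.
Definition quadE := (quad_mul1E, quad_mul2E, quad_add1E, quad_add2E).

Definition quad_scal (x : {poly F}) : A := (x, 0).

(** The element [t + w], whose norm is [Delta + t ^+ 2 + b * t]. *)
Definition quad_theta (t : {poly F}) : A := (t, 1).

(** The vector with coordinates [(u, v)] in the basis [a], [t + w]. *)
Definition quad_lvec (a t u v : {poly F}) : A := (a * u + t * v, v).

Definition qnorm (z : A) : {poly F} :=
  z.1 ^+ 2 + b * z.1 * z.2 + Delta * z.2 ^+ 2.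

(** The conjugate of [w] is [w + b], the other root of [X ^+ 2 + b * X]
    [= Delta]. *)
Definition qconj (z : A) : A := (z.1 + b * z.2, z.2).
End QuadRing.

Section CharTwo.
Variables (F : finFieldType) (b Delta : {poly F}).
Hypothesis nat2E : 2%:R = 0 :> {poly F}.
Local Notation A := (quad b Delta).
Local Notation scal := (quad_scal b Delta).
Local Notation theta := (quad_theta b Delta).
Local Notation lvec := (quad_lvec b Delta).

(** The [ring] tactic computes with integer coefficients, and a hypothesis
    [c = d] makes it replace only the coefficients equal to [c].  The identities
    below have their coefficients between 0 and 8. *)
Let nat3E : 3%:R = 1 :> {poly F}.
Proof. by rewrite (natrD _ 2 1) nat2E add0r. Qed.
Let nat4E : 4%:R = 0 :> {poly F}.
Proof. by rewrite (natrM _ 2 2) nat2E mul0r. Qed.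
Let nat5E : 5%:R = 1 :> {poly F}.
Proof. by rewrite (natrD _ 4 1) nat4E add0r. Qed.
Let nat6E : 6%:R = 0 :> {poly F}.
Proof. by rewrite (natrM _ 2 3) nat2E mul0r. Qed.
Let nat7E : 7%:R = 1 :> {poly F}.
Proof. by rewrite (natrD _ 6 1) nat6E add0r. Qed.
Let nat8E : 8%:R = 0 :> {poly F}.
Proof. by rewrite (natrM _ 2 4) nat2E mul0r. Qed.
Ltac ring2 := ring: nat2E nat3E nat4E nat5E nat6E nat7E nat8E.

Lemma oppE (y : {poly F}) : - y = y.
Proof.
apply/eqP; rewrite -subr_eq0 -opprD oppr_eq0.
by rewrite -mulr2n -mulr_natl nat2E mul0r.
Qed.

Lemma mul_qconj (z : A) : z * qconj z = scal (qnorm z).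
Proof. apply: quad_eq; rewrite !quadE /qnorm /=; ring2. Qed.

Lemma qconjM (z w : A) : qconj (z * w) = qconj z * qconj w.
Proof. apply: quad_eq; rewrite !quadE /= ?quadE; ring2. Qed.

Lemma scalM x y : scal (x * y) = scal x * scal y.
Proof. by apply: quad_eq; rewrite !quadE /=; ring. Qed.

Lemma scal_theta x y : scal x * theta y = (x * y, x).
Proof. by apply: quad_eq; rewrite !quadE /=; ring. Qed.

Lemma snd_scal x (z : A) : (scal x * z).2 = x * z.2.
Proof. by rewrite !quadE /=; ring. Qed.

Lemma qconj_scal x (z : A) : qconj (scal x * z) = scal x * qconj z.
Proof. by rewrite qconjM; congr (_ * _); apply: quad_eq => /=; ring. Qed.

Lemma qnormM (z w : A) : qnorm (z * w) = qnorm z * qnorm w.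
Proof. rewrite /qnorm !quadE; ring2. Qed.

(** [R] is integrally closed: [k / a] is a root of a monic polynomial over
    [R], hence lies in [R]. *)
Lemma dvdp_of_monic_quad (a k m : {poly F}) :
  a != 0 -> k ^+ 2 + b * a * k = a ^+ 2 * m -> a %| k.
Proof.
move=> a0 e; set d := gcdp a k.
have d0 : d != 0 by rewrite gcdp_eq0 negb_and a0.
have ea := divpK (dvdp_gcdl a k); have ek := divpK (dvdp_gcdr a k).
rewrite -/d in ea ek; set a' := a %/ d in ea *; set k' := k %/ d in ek *.
have cop : coprimep a' k' by apply: coprimep_div_gcd; rewrite a0.
have e' : k' ^+ 2 + b * a' * k' = a' ^+ 2 * m.
  apply: (mulIf (expf_neq0 2 d0)).
  have -> : a' ^+ 2 * m * d ^+ 2 = (a' * d) ^+ 2 * m by ring.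
  by rewrite ea -e -ea -ek; ring.
have dv : a' %| k' ^+ 2.
  have -> : k' ^+ 2 = a' * (a' * m + b * k').
    have -> : a' * (a' * m + b * k') = a' ^+ 2 * m + b * a' * k' by ring.
    by rewrite -e'; ring2.
  exact: dvdp_mulr.
have a'1 : a' %= 1.
  by apply: (coprimepP _ _ (coprimep_expr 2 cop)) => //; apply: dvdpp.
rewrite -ea -ek; apply: dvdp_mul => //.
by rewrite (eqp_dvdl _ a'1) dvd1p.
Qed.

Hypothesis Delta_notin : ~ range (phi b) Delta.

Lemma addr_eq0_eq (x y : {poly F}) : x + y = 0 -> x = y.
Proof. by move=> e; rewrite -[x]addr0 -e; ring2. Qed.

(** If [x + y * w] has norm zero and [y != 0], then [u = x / y] satisfies
    [u ^+ 2 + b * u = Delta]; it lies in [R] because [R] is integrally closed,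
    and this contradicts the choice of [Delta]. *)
Lemma qnorm_eq0 (z : A) : qnorm z = 0 -> z = 0.
Proof.
case: z => x y; rewrite /qnorm /= => e.
have [y0|y0] := eqVneq y 0.
  move/eqP: e; rewrite y0 mulr0 expr0n mulr0 !addr0 expf_eq0 /= => /eqP ->.
  by [].
have e' : x ^+ 2 + b * y * x = y ^+ 2 * Delta.
  by apply: addr_eq0_eq; rewrite -e; ring.
have /divpK ek := dvdp_of_monic_quad y0 e'; set u := x %/ y in ek.
case: Delta_notin; exists u => //; apply: (mulfI (expf_neq0 2 y0)).
by rewrite -e' -ek /phi; ring.
Qed.

Lemma quad_mulf_eq0 (k z : A) : k != 0 -> k * z = 0 -> z = 0.
Proof.
move=> k0 e; apply: qnorm_eq0; have /eqP : qnorm k * qnorm z = 0.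
  by rewrite -qnormM e /qnorm /=; ring.
by rewrite mulf_eq0 => /orP[] /eqP // /qnorm_eq0 k00; rewrite k00 eqxx in k0.
Qed.

Lemma quad_mulI (k : A) : k != 0 -> injective ( *%R k).
Proof.
move=> k0 x y e; apply/eqP; rewrite -subr_eq0; apply/eqP.
by apply: (quad_mulf_eq0 k0); rewrite mulrBr e subrr.
Qed.

Lemma quad_mulf_neq0 (k l : A) : k != 0 -> l != 0 -> k * l != 0.
Proof. by move=> k0; apply: contra_neq => /(quad_mulf_eq0 k0). Qed.

(** * Lattices up to similarity *)

(** The lattice [R * a + R * (t + w)]; it is an ideal of the order when [a]
    divides [Delta + t ^+ 2 + b * t]. *)
Definition lat (a t : {poly F}) : set A :=
  [set z | exists u v, z = lvec a t u v].

(** Equality up to a factor in the fraction field, written without fractions;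
    on invertible ideals this is equality of ideal classes. *)
Definition similar (L M : set A) : Prop :=
  exists k l : A, [/\ k != 0, l != 0 & *%R k @` L = *%R l @` M].

Lemma similar_refl L : similar L L.
Proof. by exists 1, 1; rewrite !oner_neq0. Qed.

Lemma similar_sym L M : similar L M -> similar M L.
Proof. by move=> [k [l [k0 l0 e]]]; exists l, k. Qed.

Lemma image_mul (k l : A) (L : set A) :
  *%R k @` ( *%R l @` L) = *%R (k * l) @` L.
Proof. by rewrite image_comp; apply: eq_imagel => z _; apply: mulrA. Qed.

Lemma similar_trans L M N : similar L M -> similar M N -> similar L N.
Proof.
move=> [k [l [k0 l0 e]]] [k' [l' [k0' l0' e']]].
exists (k' * k), (l * l'); rewrite !quad_mulf_neq0 //; split=> //.
by rewrite -image_mul e -(image_mul l) -e' !image_mul mulrC.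
Qed.

(** Two terms suffice: if [M] is generated by [m1] and [m2] then every element
    of the product of [L] and [M] is [x1 * m1 + x2 * m2] with [x1], [x2] in
    [L]. *)
Definition lat_prod (L M : set A) : set A :=
  [set z | exists x1 x2 y1 y2,
     [/\ L x1, L x2, M y1, M y2 & z = x1 * y1 + x2 * y2]].

Lemma lat_prod_scale (k l : A) L M :
  lat_prod ( *%R k @` L) ( *%R l @` M) = *%R (k * l) @` lat_prod L M.
Proof.
apply/seteqP; split=> z.
  move=> [? [? [? [? [[x1 L1 <-] [x2 L2 <-] [y1 M1 <-] [y2 M2 <-] ->]]]]].
  exists (x1 * y1 + x2 * y2); first by exists x1, x2, y1, y2.
  by rewrite mulrDr !(mulrACA k l).
move=> [_ [x1 [x2 [y1 [y2 [L1 L2 M1 M2 ->]]]]] <-].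
exists (k * x1), (k * x2), (l * y1), (l * y2).
split; [by exists x1|by exists x2|by exists y1|by exists y2|].
by rewrite mulrDr !(mulrACA k l).
Qed.

Lemma similar_lat_prod L L' M M' : similar L L' -> similar M M' ->
  similar (lat_prod L M) (lat_prod L' M').
Proof.
move=> [k [l [k0 l0 e]]] [k' [l' [k0' l0' e']]].
exists (k * k'), (l * l'); rewrite !quad_mulf_neq0 //; split=> //.
by rewrite -!lat_prod_scale e e'.
Qed.

(** * Orientations *)

Variable G : {set F}.
Hypothesis zmodG : zmod_closed G.
Hypothesis notin1G : 1 \notin G.
Hypothesis orG : forall x, x \in G \/ x + 1 \in G.
Hypothesis b_neq0 : b != 0.
Hypothesis sqrF : forall x : F, exists y, x = y ^+ 2.
Local Notation Rb := (Rset G b).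

(** Membership only depends on the quotient by [b]: this turns the closure
    properties of [Rb] into those of [G]. *)
Lemma in_Rset k : Rb k <-> (k %/ b).[0] \in G.
Proof.
split=> [[q [r [-> sr q0]]]|kG]; first by rewrite divp_addl_mul_small.
by exists (k %/ b), (k %% b); rewrite -divp_eq ltn_modp.
Qed.

Lemma Rset_add k l : Rb k -> Rb l -> Rb (k + l).
Proof.
move=> /in_Rset kG /in_Rset lG; apply/in_Rset; rewrite divpD hornerD.
have [G0 GB] := zmodG; have addE (x y : F) : x + y = x - (0 - y).
  by rewrite sub0r opprK.
by rewrite addE; apply/GB => //; apply/GB.
Qed.

Lemma Rset0 : Rb 0.
Proof. by apply/in_Rset; rewrite div0p horner0; case: zmodG. Qed.

Lemma Rset_b : ~ Rb b.
Proof. by move/in_Rset; rewrite divpp // hornerC; apply/negP. Qed.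

Lemma Rset_or k : Rb k \/ Rb (k + b).
Proof.
have [kG|kG] := orG (k %/ b).[0]; [left|right]; apply/in_Rset => //.
by rewrite divpD divpp // hornerD hornerC.
Qed.

Lemma Rset_mulX k : b * 'X %| k -> Rb k.
Proof.
case/dvdpP => q ->; apply/in_Rset.
rewrite mulrCA mulrC mulpK // hornerM hornerX mulr0; exact: (proj1 zmodG).
Qed.

Lemma Rset_addl k l : Rb k -> Rb (k + l) -> Rb l.
Proof. by move=> kG /(Rset_add kG); suff -> : k + (k + l) = l by []; ring2. Qed.

(** The product [qa f * qc f] is the norm of both [t + w] and [t + b + w].
    Exactly one of [t], [t + b] lies in [Rb], so [Rb] singles out one of the two
    conjugate lattices attached to [f]. *)
Definition oriented (f : bqf F) (t : {poly F}) : Prop :=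
  Rb t /\ qa f * qc f = Delta + t ^+ 2 + b * t.

Lemma forms_oriented f : forms b Delta f -> exists t, oriented f t.
Proof.
move=> [_ _ [t _ e]].
have e' : qa f * qc f = Delta + t ^+ 2 + b * t.
  by rewrite -[LHS](subrK Delta) -e /phi; ring.
have [tR|tR] := Rset_or t; first by exists t.
by exists (t + b); split=> //; rewrite e'; ring2.
Qed.

Lemma disc_neq0 t : Delta + t ^+ 2 + b * t != 0.
Proof.
apply/eqP => e; apply: Delta_notin; exists t => //; rewrite /phi.
by apply/esym/addr_eq0_eq; rewrite -e; ring.
Qed.

Lemma root_choice (s t a : {poly F}) :
  s ^+ 2 + b * a * s = t ^+ 2 + b * a * t -> s = t \/ s = t + b * a.
Proof.
move=> e; have /eqP : (s + t) * (s + t + b * a) = 0.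
  have -> : (s + t) * (s + t + b * a) =
    (s ^+ 2 + b * a * s) + (t ^+ 2 + b * a * t) by ring2.
  by rewrite e; ring2.
rewrite mulf_eq0 => /orP[] /eqP /addr_eq0_eq; first by left.
by move=> <-; right; ring2.
Qed.

Lemma oriented_uniq f s t : oriented f s -> oriented f t -> s = t.
Proof.
move=> [sR es] [tR et]; have est : s ^+ 2 + b * 1 * s = t ^+ 2 + b * 1 * t.
  by rewrite mulr1; apply: (addrI Delta); rewrite !addrA -es -et.
have [//|e] := root_choice est; case: Rset_b.
by apply: (Rset_addl tR); rewrite e mulr1 in sR.
Qed.

(** * Proper equivalence is similarity of lattices *)

Definition value (f : bqf F) (x y : {poly F}) :=
  qa f * x ^+ 2 + qb f * x * y + qc f * y ^+ 2.

Definition cross (f : bqf F) (p q r s : {poly F}) :=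
  qa f * p * r + qb f * q * r + qc f * q * s.

(** With [P] and [Q] the vectors of the lattice of [f] with coordinates
    [(p, q)] and [(r, s)], this is the multiplicativity of the norm applied to
    the product of [Q] and the conjugate of [P], divided by [qa f]. *)
Lemma value_crossM f p q r s : qb f = b ->
  value f p q * value f r s =
  cross f p q r s ^+ 2 + b * (p * s + q * r) * cross f p q r s +
  (p * s + q * r) ^+ 2 * (qa f * qc f).
Proof. by move=> fb; rewrite /value /cross fb; ring2. Qed.

(** The cross term is, up to a multiple of [t] and after division by [a], the
    first coordinate of the product of one lattice vector with the conjugate of
    another; the second coordinate is their determinant. *)
Lemma lvec_crossM a c t p q r s (f := Bqf a b c) :
  a * c = Delta + t ^+ 2 + b * t ->
  qconj (lvec a t p q) * lvec a t r s =
  scal a * (cross f p q r s + (p * s + q * r) * t, p * s + q * r).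
Proof.
move=> e; have e1 : Delta = a * c + t ^+ 2 + b * t by rewrite e; ring2.
by apply: quad_eq; rewrite !quadE /= /cross /= ?e1; ring2.
Qed.

Lemma qnorm_lvec a c t p q (f := Bqf a b c) :
  a * c = Delta + t ^+ 2 + b * t -> qnorm (lvec a t p q) = a * value f p q.
Proof.
move=> e; have e1 : Delta = a * c + t ^+ 2 + b * t by rewrite e; ring2.
by rewrite /qnorm /value /= e1; ring2.
Qed.

Lemma value_cross f t p q r s : qb f = b ->
  qa f * qc f = Delta + t ^+ 2 + b * t -> p * s + q * r = 1 ->
  value f p q * value f r s =
  Delta + (cross f p q r s + t) ^+ 2 + b * (cross f p q r s + t).
Proof. by move=> fb e d; rewrite value_crossM // d e; ring2. Qed.

(** Let [P] and [Q] be a basis of the lattice of [f].  Multiplication by the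
    conjugate of [P] carries it to [a] times the standard basis of the lattice
    of the transformed form, in which [t] has increased by the cross term. *)
Lemma lvec_cross a c t p q r s x y (f := Bqf a b c) :
  a * c = Delta + t ^+ 2 + b * t -> p * s + q * r = 1 ->
  qconj (lvec a t p q) * lvec a t (p * x + r * y) (q * x + s * y) =
  scal a * lvec (value f p q) (cross f p q r s + t) x y.
Proof.
move=> e d; have e1 : Delta = a * c + t ^+ 2 + b * t by rewrite e; ring2.
apply: quad_eq; rewrite !quadE /= /value /cross /= ?e1; last first.
  by rewrite -[y in RHS]mul1r -d; ring2.
rewrite -[in RHS](mul1r t) -d; ring2.
Qed.

Lemma quad_neq0l (x y : {poly F}) : x != 0 -> ((x, y) : A) != 0.
Proof. by apply: contra_neq => /(congr1 (fun z : A => z.1)). Qed.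
Lemma quad_neq0r (x y : {poly F}) : y != 0 -> ((x, y) : A) != 0.
Proof. by apply: contra_neq => /(congr1 (fun z : A => z.2)). Qed.

Lemma scal_neq0 a : a != 0 -> scal a != 0.
Proof. exact: quad_neq0l. Qed.

Lemma lvec_eq0 a t u v : a != 0 -> lvec a t u v = 0 -> u = 0 /\ v = 0.
Proof.
move=> a0 e; have v0 : v = 0 by have /= := congr1 (fun z : A => z.2) e.
have /= := congr1 (fun z : A => z.1) e; rewrite v0 mulr0 addr0 => /eqP.
by rewrite mulf_eq0 (negPf a0) => /eqP.
Qed.

Lemma qconj_eq0 (z : A) : qconj z = 0 -> z = 0.
Proof.
case: z => x y e; have /= y0 := congr1 (fun z : A => z.2) e.
have /= := congr1 (fun z : A => z.1) e.
by rewrite y0 mulr0 addr0 => ->.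
Qed.

Lemma disc_mul_neq0 a c t : a * c = Delta + t ^+ 2 + b * t -> a != 0 /\ c != 0.
Proof. by move=> e; move: (disc_neq0 t); rewrite -e mulf_eq0 negb_or => /andP. Qed.

Lemma similar_cross a c t p q r s (f := Bqf a b c) :
  a * c = Delta + t ^+ 2 + b * t -> p * s + q * r = 1 ->
  similar (lat a t) (lat (value f p q) (cross f p q r s + t)).
Proof.
move=> e d; have [a0 _] := disc_mul_neq0 e.
exists (qconj (lvec a t p q)), (scal a); split.
- apply/eqP => /qconj_eq0 /(lvec_eq0 a0) [p0 q0].
  by move/eqP: d; rewrite p0 q0 !mul0r addr0 eq_sym oner_eq0.
- exact: scal_neq0.
apply/seteqP; split=> _ [_ [u [v ->]] <-].
  exists (lvec (value f p q) (cross f p q r s + t)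
            (s * u + r * v) (q * u + p * v)).
    by exists (s * u + r * v), (q * u + p * v).
  rewrite -(lvec_cross _ _ e d); congr (_ * quad_lvec _ _ _ _ _ _).
    by rewrite -[RHS]mulr1 -d; ring2.
  by rewrite -[RHS]mulr1 -d; ring2.
exists (lvec a t (p * u + r * v) (q * u + s * v)).
  by exists (p * u + r * v), (q * u + s * v).
by rewrite (lvec_cross _ _ e d).
Qed.

Lemma proper_equivP f f' : qb f = b ->
  (proper_equiv G f f' <->
   [/\ primitive_form f, primitive_form f', qb f' = b &
       exists p q r s, [/\ p * s + q * r = 1, qa f' = value f p q,
         qc f' = value f r s & Rb (cross f p q r s)]]).
Proof.
move=> fb; split.
  move=> [pf pf' [g [dg ef kR]]]; split => //.
    by rewrite -ef /= fb.
  exists (g 0 0), (g 0 1), (g 1 0), (g 1 1); split.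
  - by rewrite -dg det_mx22 oppE.
  - by rewrite -ef /value /=.
  - by rewrite -ef /value /=.
  - by rewrite fb in kR.
move=> [pf pf' fb' [p [q [r [s [d ea ec kR]]]]]]; split=> //.
exists (\matrix_(i, j) if i == 0 then (if j == 0 then p else q)
                       else (if j == 0 then r else s)); split.
- by rewrite det_mx22 !mxE /= oppE.
- rewrite /form_act !mxE /=; move: ea ec fb'; rewrite /value fb.
  by case: f' {pf'} => a' b' c' /= -> -> ->.
- by rewrite /cross_term !mxE /= fb; rewrite /cross fb in kR.
Qed.

Lemma lvecE a t u v : lvec a t u v = scal u * scal a + scal v * theta t.
Proof. by apply: quad_eq; rewrite !quadE /=; ring. Qed.

Lemma lvec_inj a t x y x' y' : a != 0 ->
  lvec a t x y = lvec a t x' y' -> x = x' /\ y = y'.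
Proof.
move=> a0 h; have := congr1 (fun z : A => z.2) h.
have := congr1 (fun z : A => z.1) h.
by move=> /= + h2; rewrite h2 => /addIr /(mulfI a0).
Qed.

Lemma lvec10 a t : lvec a t 1 0 = scal a.
Proof. by apply: quad_eq => /=; ring. Qed.

Lemma lvec01 a t : lvec a t 0 1 = theta t.
Proof. by apply: quad_eq => /=; ring. Qed.

(** A similarity of lattices is given by a matrix invertible over [R]; its
    determinant is a nonzero constant, hence a square, and rescaling the
    similarity by the square root makes the determinant 1. *)
Lemma similar_matrix a t a' t' : a != 0 -> similar (lat a t) (lat a' t') ->
  exists (k l : A) (p q r s : {poly F}), [/\ l != 0, p * s + q * r = 1,
    l * scal a' = k * lvec a t p q & l * theta t' = k * lvec a t r s].
Proof.
move=> a0 [k [l [k0 l0 e]]].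
have [u [v eu]] : exists u v, l * scal a' = k * lvec a t u v.
  have : ( *%R l @` lat a' t') (l * scal a').
    by exists (scal a') => //; exists 1, 0; apply: quad_eq => /=; ring.
  by rewrite -e => -[_ [p [q ->]] <-]; exists p, q.
have [r [s er]] : exists u v, l * theta t' = k * lvec a t u v.
  have : ( *%R l @` lat a' t') (l * theta t').
    by exists (theta t') => //; exists 0, 1; apply: quad_eq => /=; ring.
  by rewrite -e => -[_ [p [q ->]] <-]; exists p, q.
have [u' [v' eu']] : exists u v, k * scal a = l * lvec a' t' u v.
  have : ( *%R k @` lat a t) (k * scal a).
    by exists (scal a) => //; exists 1, 0; apply: quad_eq => /=; ring.
  by rewrite e => -[_ [p [q ->]] <-]; exists p, q.
have [r' [s' er']] : exists u v, k * theta t = l * lvec a' t' u v.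
  have : ( *%R k @` lat a t) (k * theta t).
    by exists (theta t) => //; exists 0, 1; apply: quad_eq => /=; ring.
  by rewrite e => -[_ [p [q ->]] <-]; exists p, q.
have comb x y :
  l * lvec a' t' x y = k * lvec a t (x * u + y * r) (x * v + y * s).
  rewrite lvecE mulrDr mulrCA eu (mulrCA l (scal y)) er [in RHS]lvecE !lvecE.
  have scalD u1 u2 : scal (u1 + u2) = scal u1 + scal u2.
    by apply: quad_eq; rewrite !quadE /=; ring.
  by rewrite !scalD !scalM; ring.
have [] : u' * u + v' * r = 1 /\ u' * v + v' * s = 0.
  apply: (lvec_inj a0 (t := t)); apply: (quad_mulI k0).
  rewrite -comb -eu'; congr (_ * _).
  by apply: quad_eq => /=; ring.
move=> i11 i12.
have [] : r' * u + s' * r = 0 /\ r' * v + s' * s = 1.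
  apply: (lvec_inj a0 (t := t)); apply: (quad_mulI k0).
  rewrite -comb -er'; congr (_ * _).
  by apply: quad_eq => /=; ring.
move=> i21 i22.
have dd : (u * s + v * r) * (u' * s' + v' * r') = 1.
  have -> : (u * s + v * r) * (u' * s' + v' * r') =
    (u' * u + v' * r) * (r' * v + s' * s) +
    (u' * v + v' * s) * (r' * u + s' * r) by ring2.
  by rewrite i11 i12 i21 i22; ring.
have : u * s + v * r \is a GRing.unit.
  by apply/unitrP; exists (u' * s' + v' * r'); rewrite dd mulrC dd.
rewrite poly_unitE => /andP[/eqP sz _].
have [c ec] : exists c : F, u * s + v * r = c%:P.
  by exists (u * s + v * r)`_0; apply: size1_polyC; rewrite sz.
have [y ey] := sqrF c.
have y0 : y != 0.
  apply/eqP => y0; move: dd; rewrite ec ey y0 expr0n /= mul0r => /eqP.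
  by rewrite eq_sym oner_eq0.
have yy : y^-1%:P * y%:P = 1 :> {poly F} by rewrite -polyCM mulVf.
pose w := y^-1%:P.
exists (k * scal y%:P), l, (w * u), (w * v), (w * r), (w * s); split => //.
- have -> : w * u * (w * s) + w * v * (w * r) = w ^+ 2 * (u * s + v * r) by ring.
  by rewrite ec ey polyCM -expr2 -exprMn yy expr1n.
- rewrite eu -mulrA; congr (_ * _); apply: quad_eq; rewrite !quadE /=.
    by rewrite -[LHS]mul1r -yy -/w; ring.
  by rewrite -[LHS]mul1r -yy -/w; ring.
- rewrite er -mulrA; congr (_ * _); apply: quad_eq; rewrite !quadE /=.
    by rewrite -[LHS]mul1r -yy -/w; ring.
  by rewrite -[LHS]mul1r -yy -/w; ring.
Qed.

(** The matrix of the similarity takes [f] to [f'].  Comparing the products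
    of the second basis vector with the conjugate of the first, on both sides,
    gives the scale factor and shows that the cross term is [t + t']; it lies
    in [Rb] because [t] and [t'] do. *)
Lemma similar_proper f f' t t' : forms b Delta f -> forms b Delta f' ->
  oriented f t -> oriented f' t' -> similar (lat (qa f) t) (lat (qa f') t') ->
  proper_equiv G f f'.
Proof.
case: f f' => a b1 c [a' b2 c'] [/= pf fb _] [/= pf' fb' _]; subst b1 b2.
rewrite /oriented /= => -[tR et] [tR' et'] sm; set f := Bqf a b c.
have [a0 c0] := disc_mul_neq0 et; have [a0' c0'] := disc_mul_neq0 et'.
have [k [l [p [q [r [s [l0 d e1 e2]]]]]]] := similar_matrix a0 sm.
set kk := cross f p q r s; set A1 := value f p q.
have cjl : qconj (l * scal a') = qconj l * scal a'.
  by rewrite qconjM; congr (_ * _); apply: quad_eq => /=; ring.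
have cjk : qconj (l * scal a') = qconj k * qconj (lvec a t p q).
  by rewrite e1 qconjM.
have csP : qconj (lvec a t p q) * lvec a t p q = scal a * scal A1.
  by have := lvec_cross 1 0 et d; rewrite !mulr1 !mulr0 !addr0 lvec10.
have csQ : qconj (lvec a t p q) * lvec a t r s = scal a * theta (kk + t).
  by have := lvec_cross 0 1 et d; rewrite !mulr1 !mulr0 !add0r lvec01.
have E1 : scal (qnorm l) * (scal a' * scal a') =
          scal (qnorm k) * (scal a * scal A1).
  rewrite -csP -!mul_qconj.
  have -> : l * qconj l * (scal a' * scal a') =
    qconj (l * scal a') * (l * scal a').
    by rewrite cjl; ring.
  by rewrite cjk e1; ring.
have E2 : scal (qnorm l) * (scal a' * theta t') =
          scal (qnorm k) * (scal a * theta (kk + t)).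
  rewrite -csQ -!mul_qconj.
  have -> : l * qconj l * (scal a' * theta t') =
    qconj (l * scal a') * (l * theta t').
    by rewrite cjl; ring.
  by rewrite cjk e2; ring.
have nl : qnorm l != 0 by apply: contra_neq l0; apply: qnorm_eq0.
have F2 : qnorm l * a' = qnorm k * a.
  have := congr1 (fun z : A => z.2) E2.
  by rewrite !quadE /= !(mul0r, mulr0, addr0, add0r, mulr1).
have F1 : qnorm l * a' * t' = qnorm l * a' * (kk + t).
  have := congr1 (fun z : A => z.1) E2.
  by rewrite !quadE /= !(mul0r, mulr0, addr0, add0r, mulr1) !mulrA F2.
have F3 : qnorm l * a' * a' = qnorm l * a' * A1.
  have := congr1 (fun z : A => z.1) E1.
  by rewrite !quadE /= !(mul0r, mulr0, addr0, add0r, mulr1) !mulrA F2.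
have tk : t' = kk + t by apply: mulfI F1; rewrite mulf_neq0.
have aA : a' = A1 by apply: mulfI F3; rewrite mulf_neq0.
apply/(@proper_equivP f) => //; split => //; exists p, q, r, s; split => //.
  apply: (mulfI a0'); rewrite et' aA tk.
  exact/esym/(@value_cross f t p q r s erefl et d).
by apply: (Rset_addl tR); rewrite addrC -/kk -tk.
Qed.

(** Both lattices are described by their orientations, and the orientation of
    [f'] is that of [f] plus the cross term because [Rb] is a group. *)
Lemma proper_similar f f' t t' : forms b Delta f ->
  oriented f t -> proper_equiv G f f' -> oriented f' t' ->
  similar (lat (qa f) t) (lat (qa f') t').
Proof.
move=> [_ fb _] [tR et] /(proper_equivP _ fb).
move=> [_ _ fb' [p [q [r [s [d ea ec kR]]]]]] o'.
have -> : t' = cross f p q r s + t.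
  apply: oriented_uniq o' _; split; first exact: Rset_add.
  by rewrite ea ec -value_cross.
by case: f fb et ea ec kR => a b' c /= -> et -> _ _; apply: similar_cross.
Qed.

Lemma proper_forms f f' : forms b Delta f -> proper_equiv G f f' ->
  forms b Delta f'.
Proof.
move=> ff; have [t [tR et]] := forms_oriented ff.
have [_ fb _] := ff.
move=> /(proper_equivP _ fb) [_ pf' fb' [p [q [r [s [d ea ec kR]]]]]].
split=> //; rewrite ea ec (value_cross fb et d).
by exists (cross f p q r s + t) => //; rewrite /phi; ring.
Qed.

Lemma form_class_eq f f' t t' : forms b Delta f -> forms b Delta f' ->
  oriented f t -> oriented f' t' -> similar (lat (qa f) t) (lat (qa f') t') ->
  form_class G f = form_class G f'.
Proof.
move=> ff ff' o o' s; apply/seteqP; split=> g /= e.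
  have fg := proper_forms ff e; have [u ou] := forms_oriented fg.
  apply: (similar_proper _ _ o' ou) => //; apply: similar_trans (similar_sym s) _.
  exact: (proper_similar ff o e ou).
have fg := proper_forms ff' e; have [u ou] := forms_oriented fg.
apply: (similar_proper _ _ o ou) => //; apply: similar_trans s _.
exact: (proper_similar ff' o' e ou).
Qed.

(** * Direct compositions multiply lattices *)

Definition bilval (p q r s x y z w : {poly F}) : {poly F} :=
  p * (x * z) + q * (x * w) + r * (y * z) + s * (y * w).

Lemma meval_form_at f (u v : {mpoly {poly F}[4]}) e :
  (form_at f u v).@[e] = value f u.@[e] v.@[e].
Proof. by rewrite /form_at /value !mevalD !mevalZ !mevalM; ring. Qed.

Lemma direct_composition_eval f1 f2 f3 :
  direct_composition G f1 f2 f3 -> qb f1 = b ->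
  [/\ qb f2 = b, qb f3 = b & exists p1 q1 r1 s1 p2 q2 r2 s2,
   [/\ forall x y z w, value f1 x y * value f2 z w =
       value f3 (bilval p1 q1 r1 s1 x y z w) (bilval p2 q2 r2 s2 x y z w),
     Rb (q1 * r2 + q2 * r1) & Rb (p2 * s1 + q2 * r1)]].
Proof.
move=> [-> -> [p1 [q1 [r1 [s1 [p2 [q2 [r2 [s2 [e R1 R2]]]]]]]]]] fb.
rewrite fb in R1 R2; split=> //; exists p1, q1, r1, s1, p2, q2, r2, s2.
split=> // x y z w.
have := congr1 (meval (fun i : 'I_4 => [:: x; y; z; w]`_i)) e.
rewrite mevalM !meval_form_at /bilin !mevalD !mevalZ !mevalM !mevalXU.
by rewrite !inordK.
Qed.

Lemma dvdp1_unit (d : {poly F}) : d %| 1 -> d \is a GRing.unit.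
Proof.
by case/dvdpP=> q eq; apply/unitrP; exists q; rewrite [d * q]mulrC -eq.
Qed.

Lemma primitive_bezout (f : bqf F) :
  primitive_form f <-> exists u v w, u * qa f + v * qb f + w * qc f = 1.
Proof.
split=> [pf|[u [v [w e]]] d da db dc]; last first.
  by apply: dvdp1_unit; rewrite -e !dvdp_addr // dvdp_mull.
set g := gcdp (qb f) (qc f).
have cop : coprimep (qa f) g.
  have : gcdp (qa f) g \is a GRing.unit.
    apply: pf; first exact: dvdp_gcdl.
      exact: dvdp_trans (dvdp_gcdr _ _) (dvdp_gcdl _ _).
    exact: dvdp_trans (dvdp_gcdr _ _) (dvdp_gcdr _ _).
  by rewrite poly_unitE => /andP[].
have [[u x] /= e] := Bezout_eq1_coprimepP _ _ cop.
have [[y z] /= /andP[/dvdpP[k ek] _]] := Bezoutp (qb f) (qc f).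
rewrite -/g in ek; exists u, (x * k * y), (x * k * z).
by rewrite -e ek; ring.
Qed.

Section Bilinear.
(** Two bilinear forms compose [f1] and [f2] into [f3].  The columns [(p1, p2)],
    [(q1, q2)], [(r1, r2)], [(s1, s2)] are the images in the lattice of [f3] of
    the four products of basis vectors of the lattices of [f1] and [f2]. *)
Variables a1 c1 t1 a2 c2 t2 a3 c3 : {poly F}.
Variables p1 q1 r1 s1 p2 q2 r2 s2 : {poly F}.
Let f1 := Bqf a1 b c1.
Let f2 := Bqf a2 b c2.
Let f3 := Bqf a3 b c3.
Hypothesis e1 : a1 * c1 = Delta + t1 ^+ 2 + b * t1.
Hypothesis e2 : a2 * c2 = Delta + t2 ^+ 2 + b * t2.
Hypothesis ev : forall x y z w, value f1 x y * value f2 z w =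
       value f3 (bilval p1 q1 r1 s1 x y z w) (bilval p2 q2 r2 s2 x y z w).

(* Polarising the composition identity in one pair of variables, then in both,
   gives the minors of the two by four matrix of columns. *)
Lemma minor_pq : p1 * q2 + p2 * q1 = a1.
Proof.
apply: (mulfI b_neq0).
transitivity (value f3 (bilval p1 q1 r1 s1 1 0 1 1) (bilval p2 q2 r2 s2 1 0 1 1) +
  value f3 (bilval p1 q1 r1 s1 1 0 1 0) (bilval p2 q2 r2 s2 1 0 1 0) +
  value f3 (bilval p1 q1 r1 s1 1 0 0 1) (bilval p2 q2 r2 s2 1 0 0 1)).
  by rewrite /value /bilval /=; ring2.
by rewrite -!ev /value /=; ring2.
Qed.

Lemma minor_pr : p1 * r2 + p2 * r1 = a2.
Proof.
apply: (mulfI b_neq0).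
transitivity (value f3 (bilval p1 q1 r1 s1 1 1 1 0) (bilval p2 q2 r2 s2 1 1 1 0) +
  value f3 (bilval p1 q1 r1 s1 1 0 1 0) (bilval p2 q2 r2 s2 1 0 1 0) +
  value f3 (bilval p1 q1 r1 s1 0 1 1 0) (bilval p2 q2 r2 s2 0 1 1 0)).
  by rewrite /value /bilval /=; ring2.
by rewrite -!ev /value /=; ring2.
Qed.

Lemma minor_rs : r1 * s2 + r2 * s1 = c1.
Proof.
apply: (mulfI b_neq0).
transitivity (value f3 (bilval p1 q1 r1 s1 0 1 1 1) (bilval p2 q2 r2 s2 0 1 1 1) +
  value f3 (bilval p1 q1 r1 s1 0 1 1 0) (bilval p2 q2 r2 s2 0 1 1 0) +
  value f3 (bilval p1 q1 r1 s1 0 1 0 1) (bilval p2 q2 r2 s2 0 1 0 1)).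
  by rewrite /value /bilval /=; ring2.
by rewrite -!ev /value /=; ring2.
Qed.

Lemma minor_qs : q1 * s2 + q2 * s1 = c2.
Proof.
apply: (mulfI b_neq0).
transitivity (value f3 (bilval p1 q1 r1 s1 1 1 0 1) (bilval p2 q2 r2 s2 1 1 0 1) +
  value f3 (bilval p1 q1 r1 s1 1 0 0 1) (bilval p2 q2 r2 s2 1 0 0 1) +
  value f3 (bilval p1 q1 r1 s1 0 1 0 1) (bilval p2 q2 r2 s2 0 1 0 1)).
  by rewrite /value /bilval /=; ring2.
by rewrite -!ev /value /=; ring2.
Qed.

Lemma minor_ps_qr : p1 * s2 + p2 * s1 + (q1 * r2 + q2 * r1) = b.
Proof.
pose W x y z w := value f3 (bilval p1 q1 r1 s1 x y z w) (bilval p2 q2 r2 s2 x y z w).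
apply: (mulfI b_neq0).
transitivity ((W 1 1 1 1 + W 1 1 1 0 + W 1 1 0 1) + (W 1 0 1 1 + W 1 0 1 0 + W 1 0 0 1)
   + (W 0 1 1 1 + W 0 1 1 0 + W 0 1 0 1)).
  by rewrite /W /value /bilval /=; ring2.
by rewrite /W -!ev /value /=; ring2.
Qed.

Lemma value_p : value f3 p1 p2 = a1 * a2.
Proof.
transitivity (value f3 (bilval p1 q1 r1 s1 1 0 1 0) (bilval p2 q2 r2 s2 1 0 1 0)).
  by rewrite /bilval; congr (value f3 _ _); ring.
by rewrite -ev /value /=; ring.
Qed.

Lemma value_q : value f3 q1 q2 = a1 * c2.
Proof.
transitivity (value f3 (bilval p1 q1 r1 s1 1 0 0 1) (bilval p2 q2 r2 s2 1 0 0 1)).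
  by rewrite /bilval; congr (value f3 _ _); ring.
by rewrite -ev /value /=; ring.
Qed.

Lemma value_r : value f3 r1 r2 = c1 * a2.
Proof.
transitivity (value f3 (bilval p1 q1 r1 s1 0 1 1 0) (bilval p2 q2 r2 s2 0 1 1 0)).
  by rewrite /bilval; congr (value f3 _ _); ring.
by rewrite -ev /value /=; ring.
Qed.

Lemma value_s : value f3 s1 s2 = c1 * c2.
Proof.
transitivity (value f3 (bilval p1 q1 r1 s1 0 1 0 1) (bilval p2 q2 r2 s2 0 1 0 1)).
  by rewrite /bilval; congr (value f3 _ _); ring.
by rewrite -ev /value /=; ring.
Qed.

(** The cross term of the columns [p] and [q] is divisible by [a1], as its
    quotient is integral over [R]; this produces a root for [f3] for which
    the column [q] is the column [p] times [t2 + w], up to [a2]. *)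
Lemma bil_root3 : exists t3, a3 * c3 = Delta + t3 ^+ 2 + b * t3 /\
  cross f3 p1 p2 q1 q2 + a1 * t3 = a1 * t2.
Proof.
have [a10 _] := disc_mul_neq0 e1.
set k := cross f3 p1 p2 q1 q2.
have ek : k ^+ 2 + b * a1 * k = a1 ^+ 2 * (a2 * c2 + a3 * c3).
  have := value_crossM p1 p2 q1 q2 (erefl : qb f3 = b).
  rewrite value_p value_q minor_pq -/k /= => h.
  apply: addr_eq0_eq.
  have -> : k ^+ 2 + b * a1 * k + a1 ^+ 2 * (a2 * c2 + a3 * c3) =
    (k ^+ 2 + b * a1 * k + a1 ^+ 2 * (a3 * c3)) + a1 ^+ 2 * (a2 * c2) by ring.
  by rewrite -h; ring2.
have /divpK eu := dvdp_of_monic_quad a10 ek; set u := k %/ a1 in eu.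
exists (u + t2); rewrite -/k -eu; split; last by ring2.
apply: (mulfI (expf_neq0 2 a10)).
transitivity (a1 ^+ 2 * (a2 * c2 + a3 * c3) + a1 ^+ 2 * (a2 * c2)); first by ring2.
by rewrite -ek -eu e2; ring2.
Qed.

(** Likewise the column [r] is the column [p] times [t + w], up to [a1], where
    [t] is one of the two roots of [f1]. *)
Lemma bil_root1 t3 : a3 * c3 = Delta + t3 ^+ 2 + b * t3 ->
  exists t, (t = t1 \/ t = t1 + b) /\ cross f3 p1 p2 r1 r2 + a2 * t3 = a2 * t.
Proof.
move=> e3; set k := cross f3 p1 p2 r1 r2.
have h : a1 * a2 * (c1 * a2) = k ^+ 2 + b * a2 * k + a2 ^+ 2 * (a3 * c3).
  have := value_crossM p1 p2 r1 r2 (erefl : qb f3 = b).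
  by rewrite value_p value_r minor_pr -/k.
have ek : (k + a2 * t3) ^+ 2 + b * a2 * (k + a2 * t3) =
          (a2 * t1) ^+ 2 + b * a2 * (a2 * t1).
  apply: addr_eq0_eq.
  transitivity (k ^+ 2 + b * a2 * k + a2 ^+ 2 * (Delta + t3 ^+ 2 + b * t3) +
    a2 ^+ 2 * (Delta + t1 ^+ 2 + b * t1)); first by ring2.
  by rewrite -e3 -h -e1; ring2.
have [->|->] := root_choice ek; first by exists t1; split=> //; left.
by exists (t1 + b); split; [right|ring].
Qed.

(** The bilinear map, read in the lattices, is multiplication followed by a
    scaling: the four columns are proportional to the products of basis
    vectors. *)
Definition bil_mult (t3 t : {poly F}) : Prop :=
  let P := lvec a3 t3 p1 p2 in
  [/\ scal a2 * lvec a3 t3 q1 q2 = P * theta t2,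
      scal a1 * lvec a3 t3 r1 r2 = P * theta t &
      scal (a1 * a2) * lvec a3 t3 s1 s2 = P * theta t * theta t2].

(** The column [s] is determined by its minors with the independent columns
    [p] and [q].  Once all four columns are known, the two expressions that are
    required to lie in [Rb] are sums of two roots: this is why these conditions
    force the three roots involved to be the orientations. *)
Lemma bil_basis t3 t : a3 * c3 = Delta + t3 ^+ 2 + b * t3 ->
  cross f3 p1 p2 q1 q2 + a1 * t3 = a1 * t2 ->
  cross f3 p1 p2 r1 r2 + a2 * t3 = a2 * t ->
  a1 * c1 = Delta + t ^+ 2 + b * t ->
  [/\ bil_mult t3 t, q1 * r2 + q2 * r1 = t + t2 & p2 * s1 + q2 * r1 = t + t3].
Proof.
move=> e3 kq kr et; pose P := lvec a3 t3 p1 p2.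
have [a10 _] := disc_mul_neq0 e1; have [a20 _] := disc_mul_neq0 e2.
have [a30 c30] := disc_mul_neq0 e3.
have nP : qnorm P = a1 * a2 * a3 by rewrite (qnorm_lvec _ _ e3) value_p mulrC.
have P0 : qconj P != 0.
  apply/eqP => /qconj_eq0 h; move/eqP: nP.
  rewrite h /qnorm /= !(mulr0, expr0n) !addr0 eq_sym.
  by rewrite !mulf_eq0 (negPf a10) (negPf a20) (negPf a30).
have PP : P * qconj P = scal (a1 * a2 * a3) by rewrite mul_qconj nP.
have HQ : scal a2 * lvec a3 t3 q1 q2 = P * theta t2.
  apply: (quad_mulI P0).
  rewrite mulrCA (lvec_crossM _ _ _ _ e3) minor_pq kq -scal_theta.
  by rewrite [RHS]mulrA (mulrC (qconj P)) PP !scalM; ring.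
have HR : scal a1 * lvec a3 t3 r1 r2 = P * theta t.
  apply: (quad_mulI P0).
  rewrite mulrCA (lvec_crossM _ _ _ _ e3) minor_pr kr -scal_theta.
  by rewrite [RHS]mulrA (mulrC (qconj P)) PP !scalM; ring.
have d_qr : q1 * r2 + q2 * r1 = t + t2.
  apply: (mulfI (mulf_neq0 (mulf_neq0 a10 a20) a30)).
  have : qconj (scal a2 * lvec a3 t3 q1 q2) *
      (scal a1 * lvec a3 t3 r1 r2) =
      scal (a1 * a2 * a3) * (qconj (theta t2) * theta t).
    by rewrite HQ HR qconjM -PP; ring.
  rewrite qconj_scal mulrACA (lvec_crossM _ _ _ _ e3) mulrA -!scalM.
  move/(congr1 (fun z : A => z.2)); rewrite !snd_scal /= (mulrC a2) => h.
  by rewrite -[LHS]mulrA h; ring2.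
have HS : scal (a1 * a2) * lvec a3 t3 s1 s2 = P * theta t * theta t2.
  set S := lvec a3 t3 s1 s2; set Q := lvec a3 t3 q1 q2 in HQ.
  (* The second coordinate of the product of one vector with the conjugate of
     another is their determinant, so Z = 0 follows from its determinants
     with P and Q. *)
  set Z := scal (a1 * a2) * S + P * theta t * theta t2.
  suff Z0 : Z = 0.
    apply: quad_eq; apply: addr_eq0_eq.
      by have := congr1 (fun z : A => z.1) Z0.
    by have := congr1 (fun z : A => z.2) Z0.
  have d_ps : p1 * s2 + p2 * s1 = t + t2 + b.
    by rewrite -d_qr -minor_ps_qr; ring2.
  have PZ : (qconj P * Z).2 = 0.
    have -> : qconj P * Z = scal (a1 * a2) * (qconj P * S) +
        scal (a1 * a2 * a3) * (theta t * theta t2).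
      by rewrite -PP /Z; ring.
    rewrite (lvec_crossM _ _ _ _ e3) quad_add2E !snd_scal /= d_ps ?quadE /=; ring2.
  have QZ : (qconj Q * Z).2 = 0.
    apply: (mulfI a20); rewrite -snd_scal mulr0.
    have -> : scal a2 * (qconj Q * Z) =
        scal a2 * (scal (a1 * a2) * (qconj Q * S)) +
        scal (a1 * a2 * a3) * (scal (qnorm (theta t2)) * theta t).
      rewrite mulrA -qconj_scal HQ qconjM -PP -mul_qconj /Z mulrDr.
      have -> : scal a2 * (scal (a1 * a2) * (qconj Q * S)) =
        qconj (scal a2 * Q) * (scal (a1 * a2) * S) by rewrite qconj_scal; ring.
      by rewrite HQ qconjM; ring.
    have -> : qnorm (theta t2) = a2 * c2 by rewrite e2 /qnorm /=; ring.
    by rewrite (lvec_crossM _ _ _ _ e3) quad_add2E !snd_scal /= minor_qs; ring2.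
  have detPQ : (qconj P * Q).2 = a3 * a1.
    by rewrite (lvec_crossM _ _ _ _ e3) snd_scal /= minor_pq.
  have a31 : a3 * a1 != 0 by rewrite mulf_neq0.
  move: PZ QZ detPQ; move: (Z) (P) (Q) => [z1 z2] [x1 x2] [y1 y2].
  rewrite !quadE /= => hP hQ hd.
  apply: quad_eq => /=; apply: (mulfI a31); rewrite mulr0 -hd.
    transitivity (y1 * ((x1 + b * x2) * z2 + x2 * z1 + b * (x2 * z2)) +
                  x1 * ((y1 + b * y2) * z2 + y2 * z1 + b * (y2 * z2))).
      by ring2.
    by rewrite hP hQ !mulr0 addr0.
  transitivity (y2 * ((x1 + b * x2) * z2 + x2 * z1 + b * (x2 * z2)) +
                x2 * ((y1 + b * y2) * z2 + y2 * z1 + b * (y2 * z2))).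
    by ring2.
  by rewrite hP hQ !mulr0 addr0.
split=> //; apply: (mulfI (mulf_neq0 (mulf_neq0 a10 a20) a30)).
(* Each column is expressed through P; as the norm of P is a1 * a2 * a3, what
   remains is an identity of polynomials. *)
have q_2 : a2 * q2 = (P * theta t2).2 by rewrite -HQ !quadE /=; ring.
have r_1 : a1 * (a3 * r1 + t3 * r2) = (P * theta t).1.
  by rewrite -HR !quadE /=; ring.
have r_2 : a1 * r2 = (P * theta t).2 by rewrite -HR !quadE /=; ring.
have s_1 : a1 * a2 * (a3 * s1 + t3 * s2) = (P * theta t * theta t2).1.
  by rewrite -HS !quadE /=; ring.
have s_2 : a1 * a2 * s2 = (P * theta t * theta t2).2.
  by rewrite -HS !quadE /=; ring.
transitivity (p2 * (a1 * a2 * (a3 * s1 + t3 * s2) + t3 * (a1 * a2 * s2)) +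
   a2 * q2 * (a1 * (a3 * r1 + t3 * r2) + t3 * (a1 * r2))); first by ring2.
rewrite s_1 s_2 q_2 r_1 r_2 -nP /qnorm !quadE /=.
by move: (a3 * p1 + t3 * p2) => X; ring2.
Qed.

Lemma bil_oriented : Rset G b t1 -> Rset G b t2 ->
  Rset G b (q1 * r2 + q2 * r1) -> Rset G b (p2 * s1 + q2 * r1) ->
  exists t3, oriented f3 t3 /\ bil_mult t3 t1.
Proof.
move=> t1R t2R dR eR; have [t3 [e3 kq]] := bil_root3.
have [t [tt kr]] := bil_root1 e3.
have et : a1 * c1 = Delta + t ^+ 2 + b * t.
  by rewrite e1; case: tt => -> //; ring2.
have [hm dE eE] := bil_basis e3 kq kr et.
have tR : Rset G b t by apply: (Rset_addl t2R); rewrite addrC -dE.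
have et1 : t = t1 by apply: (@oriented_uniq f1).
subst t; exists t3; split=> //; split=> //.
by apply: (Rset_addl tR); rewrite -eE.
Qed.

(** A common divisor of [f3] divides the four products of the outer
    coefficients of [f1] and [f2], which with [b] generate the unit ideal. *)
Lemma bil_primitive : primitive_form f1 -> primitive_form f2 -> primitive_form f3.
Proof.
move=> /primitive_bezout [u [v [w /= h1]]].
move=> /primitive_bezout [u' [v' [w' /= h2]]] d /= da db dc.
have dv x y : d %| value f3 x y.
  by rewrite /value /= -!mulrA !dvdp_addr // dvdp_mulr.
apply: dvdp1_unit; rewrite -[1]mulr1 -{1}h1 -h2.
have -> : (u * a1 + v * b + w * c1) * (u' * a2 + v' * b + w' * c2) =
    u * u' * (a1 * a2) + u * w' * (a1 * c2) + w * u' * (c1 * a2) + w * w' * (c1 * c2) +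
    (v * (u' * a2 + v' * b + w' * c2) + v' * (u * a1 + w * c1)) * b by ring.
rewrite -value_p -value_q -value_r -value_s.
by rewrite !dvdp_addr // dvdp_mull.
Qed.

(** The minors include [a1], [c1] and two with sum [b]; since [f1] is
    primitive they generate the unit ideal, so the columns generate [R^2]. *)
Lemma bil_span : primitive_form f1 -> forall x y, exists i j k l,
  x = i * p1 + j * q1 + k * r1 + l * s1 /\ y = i * p2 + j * q2 + k * r2 + l * s2.
Proof.
move=> /primitive_bezout [u [v [w /= h]]] x y.
have h' : u * (p1 * q2 + p2 * q1) + v * (p1 * s2 + p2 * s1 + (q1 * r2 + q2 * r1)) +
  w * (r1 * s2 + r2 * s1) = 1 by rewrite minor_pq minor_rs minor_ps_qr.
exists (x * (u * q2 + v * s2) + y * (u * q1 + v * s1)),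
  (x * (u * p2 + v * r2) + y * (u * p1 + v * r1)),
  (x * (v * q2 + w * s2) + y * (v * q1 + w * s1)),
  (x * (v * p2 + w * r2) + y * (v * p1 + w * r1)).
by split; [rewrite -[LHS]mulr1|rewrite -[LHS]mulr1]; rewrite -h'; ring2.
Qed.

Lemma bil_similar t3 : primitive_form f1 -> oriented f3 t3 -> bil_mult t3 t1 ->
  similar (lat a3 t3) (lat_prod (lat a1 t1) (lat a2 t2)).
Proof.
move=> pf1 [_ /= e3] [HQ HR HS]; pose P := lvec a3 t3 p1 p2.
rewrite -/P in HQ HR HS.
have [a10 _] := disc_mul_neq0 e1; have [a20 _] := disc_mul_neq0 e2.
have [a30 _] := disc_mul_neq0 e3.
have key i j k l : scal (a1 * a2) *
  lvec a3 t3 (i * p1 + j * q1 + k * r1 + l * s1)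
             (i * p2 + j * q2 + k * r2 + l * s2) =
  P * (scal a1 * lvec a2 t2 i j + theta t1 * lvec a2 t2 k l).
  have -> : lvec a3 t3 (i * p1 + j * q1 + k * r1 + l * s1)
                       (i * p2 + j * q2 + k * r2 + l * s2) =
    scal i * P + scal j * lvec a3 t3 q1 q2 +
    scal k * lvec a3 t3 r1 r2 + scal l * lvec a3 t3 s1 s2.
    by apply: quad_eq; rewrite !quadE /=; ring.
  transitivity (scal i * scal (a1 * a2) * P
    + scal j * scal a1 * (scal a2 * lvec a3 t3 q1 q2)
    + scal k * scal a2 * (scal a1 * lvec a3 t3 r1 r2)
    + scal l * (scal (a1 * a2) * lvec a3 t3 s1 s2)).
    by rewrite scalM; ring.
  by rewrite HQ HR HS !lvecE !scalM; ring.
exists (scal (a1 * a2)), P; split.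
- by apply: scal_neq0; rewrite mulf_neq0.
- apply/eqP=> P0; have := qnorm_lvec p1 p2 e3; rewrite -/P P0 value_p /qnorm /=.
  rewrite !(mulr0, expr0n) !addr0 => /esym/eqP.
  by rewrite !mulf_eq0 (negPf a10) (negPf a20) (negPf a30).
apply/seteqP; split=> z.
  move=> [_ [x [y ->]] <-].
  have [i [j [k [l [-> ->]]]]] := bil_span pf1 x y.
  exists (scal a1 * lvec a2 t2 i j + theta t1 * lvec a2 t2 k l).
    exists (scal a1), (theta t1), (lvec a2 t2 i j), (lvec a2 t2 k l); split=> //.
    - by exists 1, 0; rewrite lvec10.
    - by exists 0, 1; rewrite lvec01.
    - by exists i, j.
    - by exists k, l.
  by rewrite key.
move=> [_ [_ [_ [_ [_ [[x [y ->]] [x' [y' ->]] [v [w ->]] [v' [w' ->]] ->]]]]] <-].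
pose i := x * v + x' * v'; pose j := x * w + x' * w'.
pose k := y * v + y' * v'; pose l := y * w + y' * w'.
exists (lvec a3 t3 (i * p1 + j * q1 + k * r1 + l * s1)
                   (i * p2 + j * q2 + k * r2 + l * s2)).
  by do 2 eexists.
rewrite key; congr (_ * _); apply: quad_eq; rewrite !quadE /= /i /j /k /l; ring.
Qed.

End Bilinear.

Lemma composition_similar f1 f2 f3 : forms b Delta f1 -> forms b Delta f2 ->
  direct_composition G f1 f2 f3 ->
  forms b Delta f3 /\ forall t1 t2 t3,
    oriented f1 t1 -> oriented f2 t2 -> oriented f3 t3 ->
    similar (lat (qa f3) t3) (lat_prod (lat (qa f1) t1) (lat (qa f2) t2)).
Proof.
move=> ff1 ff2 /direct_composition_eval.
have [pf1 fb1 _] := ff1; have [pf2 _ _] := ff2.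
move=> /(_ fb1) [fb2 fb3 [p1 [q1 [r1 [s1 [p2 [q2 [r2 [s2 [ev dR eR]]]]]]]]]].
have [t1 o1] := forms_oriented ff1; have [t2 o2] := forms_oriented ff2.
case: f1 f2 f3 fb1 fb2 fb3 ff1 ff2 pf1 pf2 ev o1 o2.
move=> a1 _ c1 [a2 _ c2] [a3 _ c3] /= -> -> ->.
move=> ff1 ff2 pf1 pf2 ev o1 o2; have [t1R e1] := o1; have [t2R e2] := o2.
have [t3 [o3 H]] := bil_oriented e1 e2 ev t1R t2R dR eR.
split.
  split=> //; first exact: bil_primitive ev pf1 pf2.
  by have [_ /= ->] := o3; exists t3 => //; rewrite /phi; ring.
move=> u1 u2 u3.
move=> /(oriented_uniq o1) <- /(oriented_uniq o2) <- /(oriented_uniq o3) <-.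
exact: (bil_similar e1 e2 ev pf1 o3 H).
Qed.

(** Similarity classes of lattices multiply, so the class of a direct
    composition does not depend on the representatives nor on the composition
    chosen. *)
Lemma class_mul_eq f1 f2 f3 : forms b Delta f1 -> forms b Delta f2 ->
  direct_composition G f1 f2 f3 ->
  class_mul G (form_class G f1) (form_class G f2) = form_class G f3.
Proof.
move=> ff1 ff2 dc; have [ff3 sm] := composition_similar ff1 ff2 dc.
have [t1 o1] := forms_oriented ff1; have [t2 o2] := forms_oriented ff2.
have [t3 o3] := forms_oriented ff3.
have refl f t : forms b Delta f -> oriented f t -> form_class G f f.
  by move=> ff o; apply: (similar_proper ff ff o o); apply: similar_refl.
apply/seteqP; split=> f; last first.
  move=> h; exists f1, f2, f3.
  by split=> //; [apply: (refl _ t1)|apply: (refl _ t2)].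
move=> [g1 [g2 [g3 [h1 h2 dc' h3]]]].
have fg1 := proper_forms ff1 h1; have fg2 := proper_forms ff2 h2.
have [fg3 sm'] := composition_similar fg1 fg2 dc'.
have [u1 w1] := forms_oriented fg1; have [u2 w2] := forms_oriented fg2.
have [u3 w3] := forms_oriented fg3.
rewrite (@form_class_eq f3 g3 t3 u3) //.
apply: similar_trans (sm _ _ _ o1 o2 o3) _.
apply: similar_trans (similar_sym (sm' _ _ _ w1 w2 w3)).
by apply: similar_lat_prod; [apply: (proper_similar ff1)|apply: (proper_similar ff2)].
Qed.

(** * Concordant forms *)

(** The identity behind it is [(a1 x + t y) (a2 z + t w) = a1 a2 L1 + t L2] for
    [t ^+ 2 = b t + a1 a2 c]. *)
Lemma direct_composition_concordant a1 a2 c c1 c2 a3 :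
  c1 = a2 * c -> c2 = a1 * c -> a3 = a1 * a2 ->
  direct_composition G (Bqf a1 b c1) (Bqf a2 b c2) (Bqf a3 b c).
Proof.
move=> -> -> ->; split=> //; exists 1, 0, 0, c, 0, a1, a2, b; split=> /=; last first.
- by rewrite !(mul0r, mulr0) addr0; apply: Rset0.
- by rewrite !(mul0r, mulr0) addr0; apply: Rset0.
rewrite /form_at /bilin /= -!mul_mpolyC !mpolyCM.
set x := 'X_(inord 0); set y := 'X_(inord 1).
set z := 'X_(inord 2); set w := 'X_(inord 3).
have two0 : 2%:R = 0 :> {mpoly {poly F}[4]}.
  by rewrite -(mpolyC_nat 4 _ 2) nat2E mpolyC0.
move: (mpolyC 4 a1) (mpolyC 4 a2) (mpolyC 4 b) (mpolyC 4 c) => m1 m2 mb mc.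
rewrite !mpolyC1 !mpolyC0.
(* Over the integers the two sides differ by twice the last factor. *)
transitivity ((m1 * x ^+ 2 + mb * (x * y) + m2 * mc * y ^+ 2) *
  (m2 * z ^+ 2 + mb * (z * w) + m1 * mc * w ^+ 2) + 2%:R *
  (2%:R * m1 * m2 * mc * x * y * z * w + mb ^+ 2 * mc * y ^+ 2 * w ^+ 2
   + m1 * mb * mc * x * y * w ^+ 2 + m2 * mb * mc * y ^+ 2 * z * w)).
  by rewrite two0 mul0r addr0.
by ring.
Qed.

(** Removing from [m] its common divisors with [a], again and again, leaves a
    part [q] prime to [a]; this replaces the factorisation of [m] into
    irreducibles. *)
Lemma coprime_part (a m : {poly F}) : m != 0 ->
  exists q N, [/\ coprimep q a & m %| q * a ^+ N].
Proof.
move: {2}(size m) (leqnn (size m)) => n; elim: n m => [|n IH] m.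
  by rewrite leqn0 size_poly_eq0 => ->.
move=> sm m0; have [cop|ncop] := boolP (coprimep m a).
  by exists m, 0%N; rewrite expr0 mulr1.
have g0 : gcdp m a != 0 by rewrite gcdp_eq0 (negPf m0).
have em := divpK (dvdp_gcdl m a).
have m'0 : m %/ gcdp m a != 0.
  by apply: contra_neq m0 => e; rewrite -em e mul0r.
have [|q [N [cop dv]]] := IH (m %/ gcdp m a) _ m'0.
  rewrite size_divp //; move: ncop; rewrite coprimep_def.
  have := size_poly_gt0 (gcdp m a); rewrite g0.
  case: (size (gcdp m a)) => [|[|k]] /= h1 h2; [by []|by []|].
  by rewrite leq_subLR (leq_trans sm) // addSn ltnS leq_addl.
exists q, N.+1; split => //.
by rewrite -em exprSr mulrA dvdp_mul // dvdp_gcdr.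
Qed.

Lemma dvdp_expn_coprime (d x : {poly F}) N :
  d %| x ^+ N -> coprimep d x -> d %= 1.
Proof. by move=> dv cop; apply: (coprimepP _ _ (coprimep_expr N cop)). Qed.

(** The vector [(p, q)] is chosen so that an irreducible divisor [l] of [m]
    divides [q] when it does not divide [a], divides [p] when it divides [a]
    but not [c], and neither when it divides both [a] and [c]; in each case
    [l] does not divide the value, as [l] cannot divide [a], [b'] and [c].  The
    proof follows these cases with an arbitrary common divisor [d]. *)
Lemma coprime_value f (m : {poly F}) : primitive_form f -> m != 0 ->
  exists p q, coprimep p q /\ coprimep m (value f p q).
Proof.
case: f => a b' c pf m0; have [q [N [qa dq]]] := coprime_part a m0.
have [p [M [pcq dp]]] := coprime_part (c * q) m0.
have := pcq; rewrite coprimepMr => /andP[pc pq].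
exists p, q; split=> //; apply/coprimepP => d dm dv; rewrite /value /= in dv.
have subc (e x y : {poly F}) : e %| x -> coprimep x y -> coprimep e y.
  exact: coprimep_dvdr.
have dq1 : coprimep d q.
  apply/coprimepP => e ed eq.
  have : e %| a * p ^+ 2.
    have -> : a * p ^+ 2 =
      (a * p ^+ 2 + b' * p * q + c * q ^+ 2) - q * (b' * p + c * q) by ring.
    by rewrite (dvdp_subr _ (dvdp_trans ed dv)) dvdp_mulr.
  rewrite Gauss_dvdpr ?(subc _ _ _ eq) // => ep.
  by apply: dvdp_expn_coprime ep _; apply: subc eq _; rewrite coprimep_sym.
have dp1 : coprimep d p.
  apply/coprimepP => e ed ep.
  have : e %| c * q ^+ 2.
    have -> : c * q ^+ 2 =
      (a * p ^+ 2 + b' * p * q + c * q ^+ 2) - p * (a * p + b' * q) by ring.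
    by rewrite (dvdp_subr _ (dvdp_trans ed dv)) dvdp_mulr.
  rewrite Gauss_dvdpr ?(subc _ _ _ ep) // => eq.
  by apply: dvdp_expn_coprime eq _; apply: subc ep _.
have da : d %| a ^+ N by rewrite -(Gauss_dvdpr _ dq1) (dvdp_trans dm).
have dc : d %| c ^+ M.
  have := dvdp_trans dm dp; rewrite Gauss_dvdpr // exprMn Gauss_dvdpl //.
  exact: coprimep_expr.
apply: dvdp_expn_coprime da _; apply/coprimepP => e ed ea.
have : e %| q * (b' * p + c * q).
  have -> : q * (b' * p + c * q) =
    (a * p ^+ 2 + b' * p * q + c * q ^+ 2) - a * p ^+ 2 by ring.
  by rewrite (dvdp_subr _ (dvdp_trans ed dv)) dvdp_mulr.
rewrite Gauss_dvdpr ?(subc _ _ _ ed) // => ebc.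
apply: dvdp_expn_coprime (dvdp_trans ed dc) _; apply/coprimepP => e' ee ec.
have : e' %| b' * p.
  have -> : b' * p = (b' * p + c * q) - c * q by ring.
  by rewrite (dvdp_subr _ (dvdp_trans ee ebc)) dvdp_mulr.
rewrite Gauss_dvdpl; last by apply: subc dp1; apply: dvdp_trans ee ed.
move=> eb; have := pf e' (dvdp_trans ee ea) eb ec.
by rewrite poly_unitE -size_poly_eq1 => /andP[].
Qed.

Lemma value_primitive f p q r s :
  qb f = b -> primitive_form f -> p * s + q * r = 1 ->
  primitive_form (Bqf (value f p q) b (value f r s)).
Proof.
case: f => a b' c /= -> pf d e; rewrite /value /= => eA eb eC.
apply: (pf e) => //=.
  have -> : a = (a * p ^+ 2 + b * p * q + c * q ^+ 2) * s ^+ 2 + b * (s * q)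
    + (a * r ^+ 2 + b * r * s + c * s ^+ 2) * q ^+ 2.
    transitivity (a * (p * s + q * r) ^+ 2 + b * (s * q) * ((p * s + q * r) + 1)).
      by rewrite d; ring2.
    by ring2.
  by rewrite !dvdp_addr // dvdp_mulr.
have -> : c = (a * p ^+ 2 + b * p * q + c * q ^+ 2) * r ^+ 2 + b * (r * p)
    + (a * r ^+ 2 + b * r * s + c * s ^+ 2) * p ^+ 2.
  transitivity (c * (p * s + q * r) ^+ 2 + b * (r * p) * ((p * s + q * r) + 1)).
    by rewrite d; ring2.
  by ring2.
by rewrite !dvdp_addr // dvdp_mulr.
Qed.

Lemma bX_neq0 : b * 'X != 0.
Proof. by rewrite mulf_neq0 // polyX_eq0. Qed.

(** A represented value prime to [m] becomes the leading coefficient after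
    completing the vector to a matrix of determinant 1.  The second row is
    only determined up to a multiple of the first; as the value is also prime to
    [b * 'X], that freedom suffices to make the cross term a multiple of
    [b * 'X], hence an element of [Rb]. *)
Lemma coprime_form f (m : {poly F}) : forms b Delta f -> m != 0 ->
  exists f', [/\ forms b Delta f', proper_equiv G f f', coprimep (qa f') (b * 'X) &
    coprimep (qa f') m].
Proof.
move=> ff m0; have [pf fb _] := ff.
have [p [q [cop]]] := coprime_value pf (mulf_neq0 bX_neq0 m0).
rewrite coprimepMl => /andP[cbX cm].
have [[u v] /= huv] := Bezout_eq1_coprimepP _ _ cop.
have [[x y] /= hxy] := Bezout_eq1_coprimepP _ _ cbX.
set k0 := cross f p q v u; set w := y * k0.
have d : p * (u + w * q) + q * (v + w * p) = 1 by rewrite -huv; ring2.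
have e : proper_equiv G f
    (Bqf (value f p q) b (value f (v + w * p) (u + w * q))).
  apply/(@proper_equivP f) => //; split=> //; first exact: value_primitive.
  exists p, q, (v + w * p), (u + w * q); split=> //.
  apply: Rset_mulX.
  have -> : cross f p q (v + w * p) (u + w * q) = k0 * (x * (b * 'X)).
    transitivity (k0 * (x * (b * 'X) + y * value f p q) + w * value f p q).
      by rewrite hxy /k0 /cross /value; ring.
    by rewrite /w; ring2.
  by rewrite mulrA dvdp_mull.
eexists; split; [exact: proper_forms e|exact: e| |].
  by rewrite coprimep_sym.
by rewrite coprimep_sym.
Qed.

Lemma coprimep_chinese (a m x y : {poly F}) : coprimep a m ->
  exists t, a %| t + x /\ m %| t + y.
Proof.
move=> /Bezout_eq1_coprimepP [[u v] /= e]; exists (x * v * m + y * u * a); split.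
  have -> : x * v * m + y * u * a + x = a * (u * (x + y)).
    by rewrite -[X in _ + X]mulr1 -e; ring2.
  exact: dvdp_mulr.
have -> : x * v * m + y * u * a + y = m * (v * (x + y)).
  by rewrite -[X in _ + X]mulr1 -e; ring2.
exact: dvdp_mulr.
Qed.

Lemma disc_dvdp a c t t' : a * c = Delta + t ^+ 2 + b * t -> a %| t' + t ->
  a %| Delta + t' ^+ 2 + b * t'.
Proof.
move=> e /dvdpP[q eq].
have -> : Delta + t' ^+ 2 + b * t' = a * (c + (a * q + b) * q).
  have -> : t' = t + q * a by rewrite -eq; ring2.
  by rewrite [RHS]mulrDr e; ring2.
exact: dvdp_mulr.
Qed.

Lemma lat_shift a t t' : a %| t' + t -> lat a t = lat a t'.
Proof.
move=> /dvdpP[q eq]; have -> : t' = t + q * a by rewrite -eq; ring2.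
apply/seteqP; split=> _ [u [v ->]]; exists (u + q * v), v.
  by apply: quad_eq => //=; ring2.
by apply: quad_eq => //=; ring2.
Qed.

(** Moving the orientation modulo the leading coefficient does not change the
    lattice, as long as it stays in [Rb]. *)
Lemma shift_form f t t' c' : forms b Delta f -> oriented f t ->
  coprimep (qa f) b -> qa f %| t' + t -> Rb t' ->
  qa f * c' = Delta + t' ^+ 2 + b * t' ->
  forms b Delta (Bqf (qa f) b c') /\
  form_class G f = form_class G (Bqf (qa f) b c').
Proof.
move=> ff o cop dv tR e.
have ff' : forms b Delta (Bqf (qa f) b c').
  split=> //=; last by rewrite e; exists t' => //; rewrite /phi; ring.
  move=> d /= da db _; apply: dvdp1_unit.
  by have /andP[] := coprimepP _ _ cop d da db.
split=> //; apply: (form_class_eq (t' := t') ff ff' o) => //=.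
by rewrite (lat_shift dv); apply: similar_refl.
Qed.

Lemma class_eq f f' : forms b Delta f -> proper_equiv G f f' ->
  form_class G f = form_class G f'.
Proof.
move=> ff e; have ff' := proper_forms ff e.
have [t o] := forms_oriented ff; have [t' o'] := forms_oriented ff'.
exact: (form_class_eq ff ff' o o' (proper_similar ff o e o')).
Qed.

(** Leading coefficients are first made pairwise coprime and prime to [b * 'X].
    A common orientation then comes from the Chinese remainder theorem; asking
    in addition that it vanish modulo [b * 'X] puts it in [Rb]. *)
Lemma concordant_triple f1 f2 f3 :
  forms b Delta f1 -> forms b Delta f2 -> forms b Delta f3 ->
  exists a1 a2 a3 c,
    let g1 := Bqf a1 b (a2 * a3 * c) in
    let g2 := Bqf a2 b (a1 * a3 * c) in
    let g3 := Bqf a3 b (a1 * a2 * c) in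
    [/\ forms b Delta g1, forms b Delta g2 & forms b Delta g3] /\
    [/\ form_class G f1 = form_class G g1, form_class G f2 = form_class G g2 &
        form_class G f3 = form_class G g3].
Proof.
move=> ff1 ff2 ff3.
have nz f t : oriented f t -> qa f != 0 by move=> [_ /disc_mul_neq0 []].
have [h1 [fh1 /(class_eq ff1) -> c1 _]] := coprime_form ff1 (oner_neq0 _).
have [t1 o1] := forms_oriented fh1.
have [h2 [fh2 /(class_eq ff2) -> c2 c12]] := coprime_form ff2 (nz _ _ o1).
have [t2 o2] := forms_oriented fh2.
have [h3 [fh3 /(class_eq ff3) -> c3 c123]] :=
  coprime_form ff3 (mulf_neq0 (nz _ _ o1) (nz _ _ o2)).
have [t3 o3] := forms_oriented fh3.
have cb a : coprimep a (b * 'X) -> coprimep a b.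
  by rewrite coprimepMr => /andP[].
have [u1 [d1 d1X]] := coprimep_chinese t1 0 c1.
have [|u2 [d2 d2X]] := @coprimep_chinese (qa h2) (qa h1 * (b * 'X)) t2 u1.
  by rewrite coprimepMr c12.
have [|t [dt3 dtX]] :=
  @coprimep_chinese (qa h3) (qa h2 * (qa h1 * (b * 'X))) t3 u2.
  by move: c3 c123; rewrite !coprimepMr => -> /andP[-> ->].
have tele x y z (d : {poly F}) : d %| x + y -> d %| y + z -> d %| x + z.
  move=> dx dy; have -> : x + z = (x + y) + (y + z) by ring2.
  by rewrite dvdp_addr.
have dt2 : qa h2 %| t + t2.
  apply: (tele _ u2 _ _ _ d2); apply: dvdp_trans dtX; exact: dvdp_mulr.
have dt1X : qa h1 * (b * 'X) %| t + u1.
  by apply: (tele _ u2 _ _ _ d2X); apply: dvdp_trans dtX; apply: dvdp_mull.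
have dt1 : qa h1 %| t + t1.
  by apply: (tele _ u1 _ _ _ d1); apply: dvdp_trans dt1X; apply: dvdp_mulr.
have tR : Rb t.
  apply: Rset_mulX; rewrite -[t]addr0; apply: (tele _ u1 _ _ _ d1X).
  by apply: dvdp_trans dt1X; apply: dvdp_mull.
have : qa h1 * qa h2 * qa h3 %| Delta + t ^+ 2 + b * t.
  rewrite Gauss_dvdp; last by rewrite coprimep_sym.
  rewrite Gauss_dvdp; last by rewrite coprimep_sym.
  rewrite (disc_dvdp (proj2 o1) dt1) (disc_dvdp (proj2 o2) dt2).
  by rewrite (disc_dvdp (proj2 o3) dt3).
case/dvdpP=> c ec; exists (qa h1), (qa h2), (qa h3), c.
have [|F1 E1] := shift_form fh1 o1 (cb _ c1) dt1 tR (c' := qa h2 * qa h3 * c).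
  by rewrite ec; ring.
have [|F2 E2] := shift_form fh2 o2 (cb _ c2) dt2 tR (c' := qa h1 * qa h3 * c).
  by rewrite ec; ring.
have [|F3 E3] := shift_form fh3 o3 (cb _ c3) dt3 tR (c' := qa h1 * qa h2 * c).
  by rewrite ec; ring.
by [].
Qed.

(** * Group laws *)

Lemma class_mul_concordant a1 a2 c c1 c2 a3 :
  c1 = a2 * c -> c2 = a1 * c -> a3 = a1 * a2 ->
  forms b Delta (Bqf a1 b c1) -> forms b Delta (Bqf a2 b c2) ->
  forms b Delta (Bqf a3 b c) /\
  class_mul G (form_class G (Bqf a1 b c1)) (form_class G (Bqf a2 b c2)) =
    form_class G (Bqf a3 b c).
Proof.
move=> h1 h2 h3 ff1 ff2.
have dc := direct_composition_concordant h1 h2 h3.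
by split; [exact: (proj1 (composition_similar ff1 ff2 dc))|exact: class_mul_eq].
Qed.

Local Notation classes := (classes_of_forms G b Delta).

Lemma classes_form f : forms b Delta f -> classes (form_class G f).
Proof. by exists f. Qed.

Lemma class_mul_closed X Y : classes X -> classes Y -> classes (class_mul G X Y).
Proof.
move=> [f1 ff1 <-] [f2 ff2 <-].
have [a1 [a2 [a3 [c [[F1 F2 _] [-> -> _]]]]]] := concordant_triple ff1 ff2 ff1.
have [|||F3 ->] :=
  @class_mul_concordant a1 a2 (a3 * c) _ _ (a1 * a2) _ _ _ F1 F2; try ring.
exact: classes_form.
Qed.

Lemma class_mulC X Y : classes X -> classes Y -> class_mul G X Y = class_mul G Y X.
Proof.
move=> [f1 ff1 <-] [f2 ff2 <-].
have [a1 [a2 [a3 [c [[F1 F2 _] [-> -> _]]]]]] := concordant_triple ff1 ff2 ff1.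
have [|||_ ->] :=
  @class_mul_concordant a1 a2 (a3 * c) _ _ (a1 * a2) _ _ _ F1 F2; try ring.
by have [|||_ ->] :=
  @class_mul_concordant a2 a1 (a3 * c) _ _ (a1 * a2) _ _ _ F2 F1; try ring.
Qed.

Lemma class_mulA X Y Z : classes X -> classes Y -> classes Z ->
  class_mul G X (class_mul G Y Z) = class_mul G (class_mul G X Y) Z.
Proof.
move=> [f1 ff1 <-] [f2 ff2 <-] [f3 ff3 <-].
have [a1 [a2 [a3 [c [[F1 F2 F3] [-> -> ->]]]]]] := concordant_triple ff1 ff2 ff3.
have [|||F12 ->] :=
  @class_mul_concordant a1 a2 (a3 * c) _ _ (a1 * a2) _ _ _ F1 F2; try ring.
have [|||F23 ->] :=
  @class_mul_concordant a2 a3 (a1 * c) _ _ (a2 * a3) _ _ _ F2 F3; try ring.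
have [|||_ ->] :=
  @class_mul_concordant a1 (a2 * a3) c _ _ (a1 * a2 * a3) _ _ _ F1 F23; try ring.
by have [|||_ ->] :=
  @class_mul_concordant (a1 * a2) a3 c _ _ (a1 * a2 * a3) _ _ _ F12 F3; try ring.
Qed.

Lemma forms_swap a c : forms b Delta (Bqf a b c) -> forms b Delta (Bqf c b a).
Proof.
move=> [pf _ dv]; split=> //=; last by rewrite mulrC.
by move=> d /= dc db da; apply: (pf d).
Qed.

Lemma forms1 t : forms b Delta (Bqf 1 b (Delta + t ^+ 2 + b * t)).
Proof.
split=> //=; last by rewrite mul1r; exists t => //; rewrite /phi; ring.
by move=> d /= /dvdp1_unit.
Qed.

(** All forms with leading coefficient 1 have the whole order as lattice. *)
Lemma class1 t : form_class G (Bqf 1 b (Delta + t ^+ 2 + b * t)) =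
  form_class G (Bqf 1 b Delta).
Proof.
have F0 : forms b Delta (Bqf 1 b Delta).
  by have := forms1 0; rewrite expr0n mulr0 !addr0.
have [u o] := forms_oriented (forms1 t); have [v o'] := forms_oriented F0.
apply: (form_class_eq (forms1 t) F0 o o') => /=.
by rewrite (@lat_shift 1 u v) ?dvd1p //; apply: similar_refl.
Qed.

Lemma class_mul1 X : classes X ->
  class_mul G (form_class G (Bqf 1 b Delta)) X = X.
Proof.
move=> [f ff <-]; have [t [_ e]] := forms_oriented ff.
case: f ff e => a b' c ff /= e; have [_ /= eb _] := ff; subst b'.
rewrite -(class1 t) -e.
have F1 : forms b Delta (Bqf 1 b (a * c)) by rewrite e; apply: forms1.
by have [|||_ ->] := @class_mul_concordant 1 a c _ _ a _ _ _ F1 ff; try ring.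
Qed.

(** The forms [(a, b, c)] and [(c, b, a)] are concordant, with composition
    [(a * c, b, 1)], and this form represents 1. *)
Lemma class_mulV X : classes X -> exists2 Y, classes Y &
  class_mul G Y X = form_class G (Bqf 1 b Delta).
Proof.
move=> [f ff <-]; have [t [_ e]] := forms_oriented ff.
case: f ff e => a b' c ff /= e; have [_ /= eb _] := ff; subst b'.
have ff' := forms_swap ff.
exists (form_class G (Bqf c b a)); first exact: classes_form.
have [|||FF ->] :=
  @class_mul_concordant c a 1 _ _ (a * c) _ _ _ ff' ff; try ring.
rewrite -(class1 t) -e; apply: class_eq => //.
apply/(@proper_equivP (Bqf (a * c) b 1)) => //; have [pF _ _] := FF; split=> //.
  by have := forms1 t; rewrite -e; case.
(* The entry b cancels the cross term: with 0 in its place the cross term is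
   b, which is not in Rb. *)
exists 0, 1, 1, b; rewrite /value /cross /=; split.
- by ring.
- by ring.
- by ring2.
have -> : a * c * 0 * 1 + b * 1 * 1 + 1 * 1 * b = 0 by ring2.
exact: Rset0.
Qed.

(** * Finiteness *)

(** Multiplying by the conjugate of [t + w] exchanges the two generators. *)
Lemma similar_flip a c t : a * c = Delta + t ^+ 2 + b * t ->
  similar (lat a t) (lat c (t + b)).
Proof.
move=> e; have [a0 _] := disc_mul_neq0 e.
have e1 : Delta = a * c + t ^+ 2 + b * t by rewrite e; ring2.
have key u v : theta (t + b) * lvec a t u v = scal a * lvec c (t + b) v u.
  by apply: quad_eq; rewrite !quadE /= ?e1; ring2.
exists (theta (t + b)), (scal a); split.
- by apply: quad_neq0r; apply: oner_neq0.
- exact: scal_neq0.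
apply/seteqP; split=> _ [_ [u [v ->]] <-].
  by rewrite key; exists (lvec c (t + b) v u) => //; exists v, u.
by rewrite -key; exists (lvec a t v u) => //; exists v, u.
Qed.

Lemma reduced_size_bound (sa sc st sD sb : nat) :
  (0 < sa)%N -> (0 < sb)%N -> (st < sa)%N -> (sa <= sc)%N ->
  ((sa + sc).-1 <= maxn (maxn sD (st + st).-1) (sb + st).-1)%N ->
  (sa <= sD + sb)%N.
Proof. lia. Qed.

(** Reduction as for binary quadratic forms: reduce [t] modulo [a], and flip
    when the cofactor [c1] of [a] is smaller than [a].  At the end
    [deg t < deg a <= deg c1], so [t ^+ 2] is too small to be the dominant term
    of [a * c1], which bounds [a] in terms of [Delta] and [b]. *)
Lemma similar_reduced (a c t : {poly F}) : a * c = Delta + t ^+ 2 + b * t ->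
  exists a' t', [/\ similar (lat a t) (lat a' t'),
    (size a' <= size Delta + size b)%N & (size t' <= size Delta + size b)%N].
Proof.
move: {2}(size a) (leqnn (size a)) => n; elim: n a c t => [|n IH] a c t sn e.
  have [/negP[]] := disc_mul_neq0 e; by rewrite -size_poly_eq0 -leqn0.
have [a0 c0] := disc_mul_neq0 e; set t1 := t %% a.
have st1 : (size t1 < size a)%N by rewrite ltn_modp.
have dv : a %| t1 + t.
  have -> : t1 + t = a * (t %/ a); last exact: dvdp_mulr.
  by rewrite [X in _ + X](divp_eq t a) -/t1; ring2.
have /dvdpP [c1 ec] := disc_dvdp e dv; rewrite [RHS]mulrC in ec.
rewrite (lat_shift dv); have [a10 c10] := disc_mul_neq0 (esym ec).
have [lt|ge] := ltnP (size c1) (size a).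
  have ec' : c1 * a = Delta + (t1 + b) ^+ 2 + b * (t1 + b).
    by rewrite mulrC -ec; ring2.
  have [|a' [t' [s sa st]]] := IH _ _ _ _ ec'; first by rewrite -ltnS (leq_trans lt).
  exists a', t'; split=> //; apply: similar_trans s; exact: similar_flip.
have a_gt0 : (0 < size a)%N by rewrite size_poly_gt0.
have b_gt0 : (0 < size b)%N by rewrite size_poly_gt0.
have B : ((size a + size c1).-1 <=
    maxn (maxn (size Delta) (size t1 + size t1).-1) (size b + size t1).-1)%N.
  rewrite -size_mul // -ec.
  apply: leq_trans (size_polyD _ _) _; rewrite geq_max !leq_max.
  rewrite size_polyMleq orbT andbT.
  have := size_polyD Delta (t1 ^+ 2); rewrite leq_max expr2.
  case/orP=> h; rewrite ?h //.
  by rewrite (leq_trans h (size_polyMleq _ _)) orbT.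
have sa := reduced_size_bound a_gt0 b_gt0 st1 ge B.
exists a, t1; split; [exact: similar_refl|exact: sa|].
exact: leq_trans (ltnW st1) sa.
Qed.

(** A class is recovered from any lattice similar to those of its members, and
    the reduced lattices are indexed by pairs of polynomials of bounded
    degree. *)
Lemma finite_classes : finite_set classes.
Proof.
pose M := (size Delta + size b)%N.
pose h (p : 'rV[F]_M * 'rV[F]_M) : set (bqf F) :=
  [set f | forms b Delta f /\ exists t, oriented f t /\
    similar (lat (qa f) t) (lat (rVpoly p.1) (rVpoly p.2))].
apply: (@sub_finite_set _ _ (h @` setT)); last first.
  by apply: finite_image; apply: finite_finset.
move=> _ [f ff <-]; have [t o] := forms_oriented ff.
have [a' [t' [s sa st]]] := similar_reduced (proj2 o).
exists (poly_rV a', poly_rV t') => //; rewrite /h /= !poly_rV_K //.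
apply/seteqP; split=> g /=.
  move=> [fg [u [og s']]]; apply: (similar_proper ff fg o og).
  exact: similar_trans s (similar_sym s').
move=> e; have fg := proper_forms ff e; split=> //.
have [u og] := forms_oriented fg; exists u; split=> //.
by apply: similar_trans s; apply: similar_sym; apply: (proper_similar ff o e og).
Qed.

End CharTwo.

Theorem theorem2p22 (n : nat) (F : finFieldType) (cardF : #|F| = (2 ^ n)%N)
    (G : {set F}) (zmodG : zmod_closed G) (cardG : #|G| = (2 ^ n.-1)%N)
    (notin1G : 1 \notin G) (b Delta : {poly F}) (b_neq0 : b != 0)
    (Delta_notin : ~ range (phi b) Delta) :
  (forall f1 f2 f3 : bqf F,
     forms b Delta f1 -> forms b Delta f2 -> direct_composition G f1 f2 f3 ->
     class_mul G (form_class G f1) (form_class G f2) = form_class G f3) /\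
  finite_abelian_group (classes_of_forms G b Delta) (class_mul G).
Proof.
have two0 : 2%:R = 0 :> {poly F}.
  by rewrite -polyC_natr (pow2_card_char2 cardF).
have sqrF := pow2_card_sqrt cardF.
have orG := index2_cover cardF zmodG cardG notin1G.
split.
  by move=> f1 f2 f3 ff1 ff2; apply: (@class_mul_eq F b Delta).
split.
- exact: finite_classes.
- by move=> x y; apply: class_mul_closed.
- by move=> x y z; apply: class_mulA.
- by move=> x y; apply: class_mulC.
exists (form_class G (Bqf 1 b Delta)); split.
- apply: classes_form; have := @forms1 F b Delta 0.
  by rewrite expr0n mulr0 !addr0.
- by move=> x; apply: class_mul1.
- by move=> x; apply: class_mulV.
Qed.
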